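(* Let $\Lambda\in\{\Lambda_G,\Lambda_U\}$ and let $\mathbf{a}_1,\dots,\mathbf{a}_m$ be i.i.d. with distribution $\Lambda$. Let $\mathcal{A}:S_d(\mathbb{R})\to\mathbb{R}^m$ be the rank-one projection operator $\mathcal{A}(\mathbf{M})=\frac1m\big(\langle\mathbf{a}_j\mathbf{a}_j^\top,\mathbf{M}\rangle\big)_{j=1}^m$, where $S_d(\mathbb{R})$ is equipped with $\|\cdot\|_\Lambda$ and $\mathbb{R}^m$ with $\|\cdot\|_1$. For all $\delta,\rho\in(0,1)$ there exists a constant $C=C(\delta,\rho,b/a)>0$, depending only on $\delta$, $\rho$ and the ratio $b/a$ (independent of $m$, $k$ and $d$), such that whenever $$m\ge C(d+2k)\log d,$$ the operator $\mathcal{A}$ satisfies $\operatorname{RIP}_\delta$ on $\mathfrak{S}_{k,a,b}$ with probability at least $1-\rho$. In particular, with probability at least $1-\rho$ the following holds uniformly over $\boldsymbol\Sigma\in\mathfrak{S}_{k,a,b}$: for any $\mathbf{x}_1,\dots,\mathbf{x}_n$ drawn from a centered distribution $\mu$ with covariance $\boldsymbol\Sigma$, with $\widehat{\boldsymbol\Sigma}=\frac1n\sum_i\mathbf{x}_i\mathbf{x}_i^\top$ and $\mathbf{s}=\mathcal{A}(\widehat{\boldsymbol\Sigma})$, the estimator $\boldsymbol\Sigma^\star=\Delta[\mathbf{s}]\in\arg\min_{\boldsymbol\Sigma'\in\mathfrak{S}_{k,a,b}}\|\mathcal{A}(\boldsymbol\Sigma')-\mathbf{s}\|_1$ (assumed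 to exist) satisfies $$\|\boldsymbol\Sigma^\star-\boldsymbol\Sigma\|_\Lambda\le\frac{2}{1-\delta}\|\mathcal{A}(\widehat{\boldsymbol\Sigma})-\mathcal{A}(\boldsymbol\Sigma)\|_1.$$
   Context: $S_d(\mathbb{R})$ is the space of real symmetric $d\times d$ matrices, $S_d^{++}(\mathbb{R})$ the symmetric positive definite ones, $\langle\cdot,\cdot\rangle$ the Frobenius inner product, $\|\mathbf{M}\|_0$ the number of nonzero entries. $\Lambda_G=\mathcal{N}(0,\frac1d\mathbf{I}_d)$ and $\Lambda_U$ is the uniform distribution on the unit sphere $\mathbb{S}^{d-1}$. For $\Lambda\in\{\Lambda_G,\Lambda_U\}$, $\|\mathbf{M}\|_\Lambda=\mathbb{E}_{\mathbf{a}\sim\Lambda}[|\mathbf{a}^\top\mathbf{M}\mathbf{a}|]$ (a norm on $S_d(\mathbb{R})$). For an integer $k\ge0$ and $0<a\le b$, the model set is $\mathfrak{S}_{k,a,b}=\{\boldsymbol\Sigma\in S_d^{++}(\mathbb{R}):\ \boldsymbol\Theta=\boldsymbol\Sigma^{-1},\ \|\boldsymbol\Theta\|_0\le d+2k,\ \operatorname{spec}(\boldsymbol\Theta)\subseteq[a,b]\}$. $\mathcal{A}$ satisfies $\operatorname{RIP}_\delta$ on a set $\mathfrak{S}$ if for all $\boldsymbol\Sigma_1,\boldsymbol\Sigma_2\in\mathfrak{S}$: $(1-\delta)\|\boldsymbol\Sigma_1-\boldsymbol\Sigma_2\|_\Lambda\le\|\mathcal{A}(\boldsymbol\Sigma_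1-\boldsymbol\Sigma_2)\|_1\le(1+\delta)\|\boldsymbol\Sigma_1-\boldsymbol\Sigma_2\|_\Lambda$.
   Formalization: The formal theorem assumes d ≥ 2: for d = 1, log d = 0 allows any m (e.g. m = 1 with Gaussian a), and RIP fails with non-small probability. The uniform law on the sphere is realized as a normalized Gaussian vector. *)

(* Defs.v *)
From HB Require Import structures.
From mathcomp Require Import all_boot all_order all_algebra.
From mathcomp Require Import all_classical all_reals all_analysis.
Set Implicit Arguments. Unset Strict Implicit. Unset Printing Implicit Defensive.
Import Order.TTheory GRing.Theory Num.Theory.
Local Open Scope classical_set_scope.
Local Open Scope ring_scope.

(* The two sampling distributions: Lambda_G = N(0, I_d/d), Lambda_U = uniform
   on the unit sphere S^{d-1}. *)
Inductive Lam := LamG | LamU.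

Section Defs.
Context {R : realType}.

Definition frob {d : nat} (X Y : 'M[R]_d) : R := \sum_i \sum_j X i j * Y i j.

Definition nnz {d : nat} (M : 'M[R]_d) : nat := #|[set ij : 'I_d * 'I_d | M ij.1 ij.2 != 0]|.

Definition symmetric {d : nat} (M : 'M[R]_d) : Prop := M^T = M.

Definition spd {d : nat} (M : 'M[R]_d) : Prop :=
  symmetric M /\ forall v : 'cV[R]_d, v != 0 -> 0 < (v^T *m M *m v) 0 0.

Definition spec_in {d : nat} (M : 'M[R]_d) (a b : R) : Prop :=
  forall l : R, eigenvalue M l -> a <= l <= b.

Definition model_set (d k : nat) (a b : R) : set 'M[R]_d :=
  [set S | spd S /\ let Th := invmx S in
           (nnz Th <= d + 2 * k)%N /\ spec_in Th a b].

Definition outer {d : nat} (v : 'I_d -> R) : 'M[R]_d := \matrix_(i, j) (v i * v j).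

Definition rop {m d : nat} (av : 'I_m -> 'I_d -> R) (M : 'M[R]_d) : 'I_m -> R :=
  fun j => m%:R^-1 * frob (outer (av j)) M.

Definition l1norm {m : nat} (y : 'I_m -> R) : R := \sum_j `|y j|.

(* vector of law Lambda obtained from a vector of i.i.d. N(0,1/d) coordinates:
   itself for Lambda_G, its normalization for Lambda_U *)
Definition lam_vec (L : Lam) {d : nat} (v : 'I_d -> R) : 'I_d -> R :=
  match L with
  | LamG => v
  | LamU => fun i => v i / Num.sqrt (\sum_l v l ^+ 2)
  end.

Definition mutually_independent {dT} {T : measurableType dT} {I : finType}
  (P : probability T R) (X : I -> T -> R) : Prop :=
  forall B : I -> set R, (forall i, measurable (B i)) ->
    P (\bigcap_i (X i @^-1` B i)) = (\prod_i P (X i @^-1` B i))%E.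

Definition iid_gauss {dT} {T : measurableType dT} {I : finType}
  (P : probability T R) (d : nat) (X : I -> T -> R) : Prop :=
  (forall i, measurable_fun setT (X i)) /\ mutually_independent P X /\
  forall i (B : set R), measurable B ->
    P (X i @^-1` B) = normal_prob 0 (Num.sqrt (d%:R))^-1 B.

(* ||M||_Lambda = E_{a ~ Lambda} |a^T M a|, computed with a random vector
   a = lam_vec L h of law Lambda *)
Definition lam_norm (L : Lam) {dT} {T : measurableType dT} (P : probability T R)
  {d : nat} (h : 'I_d -> T -> R) (M : 'M[R]_d) : R :=
  fine ('E_P[fun t => `| frob (outer (lam_vec L (fun i => h i t))) M |]).

Definition RIP {m d : nat} (Anorm : 'M[R]_d -> R) (Aop : 'M[R]_d -> 'I_m -> R)
  (delta : R) (S : set 'M[R]_d) : Prop :=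
  forall S1 S2, S S1 -> S S2 ->
    (1 - delta) * Anorm (S1 - S2) <= l1norm (Aop (S1 - S2)) <= (1 + delta) * Anorm (S1 - S2).

Definition emp_cov {n d : nat} (x : 'I_n -> 'I_d -> R) : 'M[R]_d :=
  n%:R^-1 *: \sum_l outer (x l).

End Defs.
Arguments model_set {R} d k a b _.

(* Main.v *)
(* Let M be the difference of two covariances S1, S2 of the model, rescaled by the sup norm
   of the difference of their inverses: M = S1 D S2, where D is a (2d+4k)-sparse matrix of
   sup norm 1.  Rounding S1^-1, S2^-1 and D to a grid of mesh 1/poly(d) leaves
   exp(O((d+2k) log d)) cells, each of which is represented by one rescaled difference.

   For a fixed symmetric M the quadratic form a^T M a of a Gaussian vector is subexponential
   at the scale of its own mean absolute value, with constants independent of d.  This comes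
   from two-sided bounds on E exp(a^T M a), obtained by integrating out one coordinate at a
   time; the form on the sphere is compared with the Gaussian one through |a|^2.  Bernstein's
   inequality and a union bound then give the RIP on all representatives as soon as
   m >= C (d+2k) log d.

   Since the mesh is polynomially small, crude estimates suffice to pass from the
   representatives to all differences: the mean of the |a_j|^2 is bounded with probability
   1 - rho/2, and the Lambda-norm of M is at least 1/poly(d). *)
Require Import Defs.
From HB Require Import structures.
From mathcomp Require Import all_boot all_order all_algebra.
From mathcomp Require Import all_classical all_reals all_analysis.
From mathcomp Require Import measurable_realfun ring lra.
Import Order.TTheory GRing.Theory Num.Theory.
Import numFieldNormedType.Exports.
Local Open Scope classical_set_scope.
Local Open Scope ring_scope.
Set Implicit Arguments. Unset Strict Implicit. Unset Printing Implicit Defensive.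

(** * Independence of random vectors *)

(** The RIP is a relative bound and differences of covariances can be arbitrarily small, so an
    absolute net of the differences themselves would not do. The rescaling uses the inverses because
    sparsity belongs to them: [S1 - S2] is dense in general. A rounded matrix need be neither
    symmetric nor invertible, which is why a cell is represented by a rescaled difference of actual
    model elements.

    The scale of the form is [sqrt (tr M ^ 2 + |M|_F ^ 2)], because the logarithm of its Gaussian
    Laplace transform is [tr M] up to a term of order [|M|_F ^ 2]. The upper bound gives the
    subexponential tail. The lower bound, applied to [M] and [- M], keeps the mean of [2 cosh] above
    2 by a fixed amount, and this forces the mean absolute value to be comparable to the scale.

    Only [b / a] enters the constant: rescaled differences have norm at least [1 / (d ^ 2 * b ^ 2)],
    while the rounding error carries [(b / a) * a ^- 2], and the quotient of the two involves
    [(b / a) ^ 3] alone. *)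

Section independence.
Context {R : realType} {dT : measure_display} {T : measurableType dT}.
Variable P : probability T R.

Definition vec n (X : 'I_n -> T -> R) (t : T) : n.-tuple R := [tuple X i t | i < n].

Lemma tnth_vec n (X : 'I_n -> T -> R) t : tnth (vec X t) = (fun i => X i t).
Proof. by apply/funext => i; rewrite tnth_mktuple. Qed.

Lemma measurable_vec n (X : 'I_n -> T -> R) :
  (forall i, measurable_fun setT (X i)) -> measurable_fun setT (vec X).
Proof.
move=> mX; apply/measurable_fun_tnthP => i.
rewrite [X in measurable_fun _ X](_ : _ = X i); first exact: mX.
by apply/funext => t /=; rewrite tnth_vec.
Qed.

Definition box n (B : 'I_n -> set R) : set (n.-tuple R) :=
  \bigcap_i ((fun v => tnth v i) @^-1` B i).

Lemma measurable_box n (B : 'I_n -> set R) :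
  (forall i, measurable (B i)) -> measurable (box B).
Proof.
move=> mB; apply: fin_bigcap_measurable => // i _.
by rewrite -[X in measurable X]setTI; apply: measurable_tnth.
Qed.

Lemma preimage_box n (X : 'I_n -> T -> R) (B : 'I_n -> set R) :
  vec X @^-1` box B = \bigcap_i (X i @^-1` B i).
Proof.
by apply/seteqP; split => t /= h i _; move: (h i I) => /=; rewrite tnth_vec.
Qed.

(** Boxes are stable under intersection and generate the product sigma-algebra, and the whole space
    is a box of finite measure. *)
Lemma box_measure_unique n (m1 m2 : {measure set (n.-tuple R) -> \bar R}) :
  (m1 setT < +oo)%E ->
  (forall B, (forall i, measurable (B i)) -> m1 (box B) = m2 (box B)) ->
  forall S, measurable S -> m1 S = m2 S.
Proof.
move=> m1T m12 S mS.
have boxT : box (fun=> setT) = [set: n.-tuple R] by apply/seteqP; split.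
pose G := [set S : set (n.-tuple R) |
  exists2 B, (forall i, measurable (B i)) & S = box B].
apply: (@measure_unique _ _ _ G (fun=> setT)) => //.
- apply/seteqP; split.
    apply: smallest_sub; first exact: smallest_sigma_algebra.
    rewrite -bigcup_seq; apply: bigcup_sub => i _ _ [B mB <-].
    apply: sub_sigma_algebra; exists (fun j => if j == i then B else setT).
      by move=> j; case: ifP.
    rewrite setTI; apply/seteqP; split => v /=.
      by move=> vB j _ /=; case: eqP => [->|].
    by move=> /(_ i I) /=; rewrite eqxx.
  apply: smallest_sub; first exact: sigma_algebra_measurable.
  by move=> _ [B mB ->]; exact: measurable_box.
- move=> _ _ [A mA ->] [B mB ->]; exists (fun i => A i `&` B i).
    by move=> i; exact: measurableI.
  apply/seteqP; split => v /=.
    by move=> [hA hB] i _; split; [exact: hA|exact: hB].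
  by move=> h; split => i _; have [] := h i I.
- by move=> _; exists (fun=> setT).
- by rewrite bigcup_const//; exists 0%N.
- by move=> _ [B mB ->]; exact: m12.
Qed.

(** Both sides are finite measures in [S], the left one a restriction of [P] pushed forward and the
    right one a multiple of the law of the vector; they agree on boxes. *)
Lemma vec_indep_event n (X : 'I_n -> T -> R) (C : set T) :
  (forall i, measurable_fun setT (X i)) -> measurable C ->
  (forall B, (forall i, measurable (B i)) ->
    P (C `&` \bigcap_i (X i @^-1` B i)) = (P C * P (\bigcap_i (X i @^-1` B i)))%E) ->
  forall S, measurable S -> P (C `&` vec X @^-1` S) = (P C * P (vec X @^-1` S))%E.
Proof.
move=> mX mC CX S mS.
have mV := measurable_vec mX.
pose c : {nonneg R} := NngNum (fine_ge0 (measure_ge0 P C)).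
have cE : (c%:num)%:E = P C by rewrite /= fineK// fin_num_measure.
pose V : {mfun T >-> n.-tuple R} := mfun_Sub (mem_set mV).
pose m2 : {measure set (n.-tuple R) -> \bar R} := mscale c (distribution P V).
pose m1' : {measure set (n.-tuple R) -> \bar R} :=
  pushforward (mrestr P mC) (vec X).
pose m1 := m1' mV.
have m1E A : m1 A = P (C `&` vec X @^-1` A) by rewrite /m1 /pushforward /mrestr/= setIC.
have m2E A : m2 A = (P C * P (vec X @^-1` A))%E by rewrite -cE.
rewrite -m1E -m2E; apply: box_measure_unique => //.
  rewrite m1E; apply: le_lt_trans (probability_le1 _ _) _; last exact: ltry.
  by rewrite preimage_setT setIT.
by move=> B mB; rewrite m1E m2E preimage_box; exact: CX.
Qed.

Lemma eq_law_vec n (X Y : 'I_n -> T -> R) :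
  (forall i, measurable_fun setT (X i)) -> (forall i, measurable_fun setT (Y i)) ->
  (forall B, (forall i, measurable (B i)) ->
    P (\bigcap_i (X i @^-1` B i)) = P (\bigcap_i (Y i @^-1` B i))) ->
  forall f : n.-tuple R -> \bar R, measurable_fun [set: n.-tuple R] f -> (forall v, 0 <= f v)%E ->
  (\int[P]_t f (vec X t) = \int[P]_t f (vec Y t))%E.
Proof.
move=> mX mY XY f mf f0.
pose U : {mfun T >-> n.-tuple R} := mfun_Sub (mem_set (measurable_vec mX)).
pose V : {mfun T >-> n.-tuple R} := mfun_Sub (mem_set (measurable_vec mY)).
have <- := @ge0_integral_distribution _ _ _ _ _ P U f mf f0.
have <- := @ge0_integral_distribution _ _ _ _ _ P V f mf f0.
apply: eq_measure_integral => S mS _.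
apply: box_measure_unique => //.
  by apply: le_lt_trans (probability_le1 _ _) _ => //; exact: ltry.
move=> B mB; have := XY B mB.
by rewrite -!preimage_box.
Qed.

(** By independence the law of the pair agrees with the product of the two laws on rectangles, hence
    everywhere, and Tonelli applies to that product. *)
Lemma indep_tonelli d1 d2 (T1 : measurableType d1) (T2 : measurableType d2)
    (U : T -> T1) (V : T -> T2) (f : T1 * T2 -> \bar R) :
  measurable_fun setT U -> measurable_fun setT V ->
  (forall A B, measurable A -> measurable B ->
    P (U @^-1` A `&` V @^-1` B) = (P (U @^-1` A) * P (V @^-1` B))%E) ->
  measurable_fun setT f -> (forall z, 0 <= f z)%E ->
  (\int[P]_t f (U t, V t) = \int[P]_t \int[P]_s f (U t, V s))%E.
Proof.
move=> mU mV UV mf f0.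
pose W : {mfun T >-> (T1 * T2)%type} := mfun_Sub (mem_set (measurable_fun_pair mU mV)).
pose U' : {mfun T >-> T1} := mfun_Sub (mem_set mU).
pose V' : {mfun T >-> T2} := mfun_Sub (mem_set mV).
have <- := @ge0_integral_distribution _ _ _ _ _ P W f mf f0.
transitivity (\int[distribution P U' \x distribution P V']_z f z)%E.
  apply: eq_measure_integral => S mS _; symmetry.
  by apply: product_measure_unique => // A B mA mB; exact: UV.
rewrite fubini_tonelli1// /fubini_F.
have := @ge0_integral_distribution _ _ _ _ _ P U'
  (fun x => \int[distribution P V']_y f (x, y))%E.
move=> -> //; last 2 first.
- exact: measurable_fun_fubini_tonelli_F.
- by move=> x; apply: integral_ge0.
apply: eq_integral => t _ /=.
have := @ge0_integral_distribution _ _ _ _ _ P V' (fun y => f (U t, y)).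
move=> -> //.
by apply: (measurableT_comp mf) => /=; exact: pair1_measurable.
Qed.

Lemma mutually_independent_inj (K J : finType) (e : J -> K) (X : K -> T -> R) :
  injective e -> mutually_independent P X ->
  mutually_independent P (fun j => X (e j)).
Proof.
move=> ie iX B mB.
(* Each fibre of [e] has at most one point, so [B' i] is either some [B j] or, off the image, the
   empty intersection [setT], which contributes a factor 1. *)
pose B' i := \bigcap_(j in [set j | e j = i]) B j.
have B'e j : B' (e j) = B j.
  apply/seteqP; split => x; first by move=> /(_ j erefl).
  by move=> Bx k /= /ie ->.
have mB' i : measurable (B' i) by apply: fin_bigcap_measurable.
have := iX B' mB'.
rewrite (_ : \bigcap_i (X i @^-1` B' i) = \bigcap_j (X (e j) @^-1` B j)); last first.
  apply/seteqP; split => t /=.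
    by move=> h j _; have := h (e j) I; rewrite /= B'e.
  by move=> h i _ /= j /= <-; exact: h.
move=> ->; rewrite (bigID (mem (codom e)))/= [X in (_ * X)%E]big1 ?mule1; last first.
  move=> i ni; rewrite (_ : B' i = setT) ?preimage_setT ?probability_setT//.
  by apply/seteqP; split => // x _ j /= ji; rewrite -ji codom_f in ni.
rewrite -big_uniq/=; last exact/injectiveP.
by rewrite big_image/=; apply: eq_bigr => j _; rewrite B'e.
Qed.

Lemma mutually_independent_head n (X : 'I_n.+1 -> T -> R) :
  (forall i, measurable_fun setT (X i)) -> mutually_independent P X ->
  forall B S, measurable B -> measurable S ->
    P (X ord0 @^-1` B `&` vec (fun i => X (lift ord0 i)) @^-1` S) =
    (P (X ord0 @^-1` B) * P (vec (fun i => X (lift ord0 i)) @^-1` S))%E.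
Proof.
move=> mX iX B S mB mS.
apply: vec_indep_event => //.
  by rewrite -[X in measurable X]setTI; apply: mX.
move=> A mA.
have iX' := mutually_independent_inj (@lift_inj _ ord0) iX.
rewrite (iX' A mA).
pose A' i := if unlift ord0 i is Some j then A j else B.
have mA' i : measurable (A' i) by rewrite /A'; case: (unlift _ _).
have := iX A' mA'; rewrite big_ord_recl {2}/A' unlift_none.
under eq_bigr do rewrite /A' liftK.
move=> <-; congr (P _); apply/seteqP; split => t /=.
  move=> [Bt At] i _ /=; rewrite /A'.
  by case: unliftP => [j ->|->//]; exact: At.
move=> h; split; first by have := h ord0 I; rewrite /= /A' unlift_none.
by move=> i _; have := h (lift ord0 i) I; rewrite /= /A' liftK.
Qed.

Lemma expectation_head_tonelli n (X : 'I_n.+1 -> T -> R) (f : n.-tuple R * R -> \bar R) :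
  (forall i, measurable_fun setT (X i)) -> mutually_independent P X ->
  measurable_fun setT f -> (forall z, 0 <= f z)%E ->
  (\int[P]_t f (vec (fun i => X (lift ord0 i)) t, X ord0 t) =
   \int[P]_t \int[P]_s f (vec (fun i => X (lift ord0 i)) t, X ord0 s))%E.
Proof.
move=> mX iX mf f0; apply: indep_tonelli => //.
  exact: measurable_vec.
by move=> A B mA mB; rewrite setIC mutually_independent_head// muleC.
Qed.

End independence.

Section independent_families.
Context {R : realType} {dT : measure_display} {T : measurableType dT}.
Variable P : probability T R.

Lemma expectation_prod n (Y : 'I_n -> T -> R) :
  (forall i, measurable_fun setT (Y i)) -> mutually_independent P Y ->
  (forall i t, 0 <= Y i t) ->
  (\int[P]_t (\prod_i Y i t)%:E = \prod_i \int[P]_t (Y i t)%:E)%E.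
Proof.
elim: n Y => [|n IH] Y mY iY Y0.
  under eq_integral do rewrite big_ord0.
  by rewrite big_ord0 integral_cst//= mul1e probability_setT.
(* Tonelli asks for a function nonnegative on all tuples, not only on the values taken by [Y]; hence
   the absolute value. *)
pose f (z : n.-tuple R * R) : \bar R := (`|z.2 * \prod_i tnth z.1 i|)%:E.
transitivity (\int[P]_t f (vec (fun i => Y (lift ord0 i)) t, Y ord0 t))%E.
  apply: eq_integral => t _; rewrite big_ord_recl /f/= tnth_vec ger0_norm//.
  by rewrite mulr_ge0// prodr_ge0.
rewrite expectation_head_tonelli//; last first.
- by move=> z; rewrite lee_fin.
- apply/measurable_EFinP; apply: measurableT_comp => //.
  apply: measurable_funM => //.
  apply: measurable_prod => i _; apply: (measurableT_comp (measurable_tnth i)) => //.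
transitivity (\int[P]_t ((\prod_i Y (lift ord0 i) t)%:E * \int[P]_s (Y ord0 s)%:E))%E.
  apply: eq_integral => t _.
  have p0 : 0 <= \prod_i Y (lift ord0 i) t by apply: prodr_ge0.
  transitivity (\int[P]_s ((\prod_i Y (lift ord0 i) t)%:E * (Y ord0 s)%:E))%E.
    apply: eq_integral => s _; rewrite /f/=.
    under eq_bigr do rewrite tnth_vec.
    by rewrite ger0_norm ?mulr_ge0// mulrC.
  rewrite ge0_integralZl//; last by move=> s _; rewrite lee_fin.
  exact/measurable_EFinP.
rewrite ge0_integralZr//; last 3 first.
- by apply/measurable_EFinP; apply: measurable_prod => i _.
- by move=> t _; rewrite lee_fin prodr_ge0.
- by apply: integral_ge0 => t _; rewrite lee_fin.
rewrite IH// ?big_ord_recl 1?muleC//.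
exact: (mutually_independent_inj (@lift_inj _ ord0) iY).
Qed.

(** The block events are freed one at a time. The induction on [k] allows arbitrary measurable sets
    in the first [k] blocks and boxes in the others; for [k = 0] this is the independence of the
    coordinates, and [vec_indep_event] frees one further block, with [C] the event carried by all
    the others. *)
Lemma mutually_independent_blocks m n (X : 'I_m * 'I_n -> T -> R)
    (f : n.-tuple R -> R) :
  (forall p, measurable_fun setT (X p)) -> mutually_independent P X ->
  measurable_fun [set: n.-tuple R] f ->
  mutually_independent P (fun j t => f (vec (fun i => X (j, i)) t)).
Proof.
move=> mX iX mf.
pose U j := vec (fun i => X (j, i)).
have mU j : measurable_fun setT (U j) by apply: measurable_vec.
pose isbox (S : set (n.-tuple R)) :=
  exists2 B : 'I_n -> set R, (forall i, measurable (B i)) & S = box B.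
have isbox_meas S : isbox S -> measurable S by move=> [B mB ->]; exact: measurable_box.
have isboxT : isbox setT by exists (fun=> setT) => //; apply/seteqP; split.
have indepU k : forall S : 'I_m -> set (n.-tuple R), (forall j, measurable (S j)) ->
    (forall j : 'I_m, (k <= j)%N -> isbox (S j)) ->
    P (\bigcap_j (U j @^-1` S j)) = (\prod_j P (U j @^-1` S j))%E.
  elim: k => [|k IH] S mS bS.
    have /choice[B BS] : forall j, exists B : 'I_n -> set R,
        (forall i, measurable (B i)) /\ S j = box B.
      by move=> j; have [B mB SB] := bS j isT; exists B.
    have -> : \bigcap_j (U j @^-1` S j) = \bigcap_p (X p @^-1` B p.1 p.2).
      apply/seteqP; split => t h.
        move=> [j i] _ /=; have := h j I; rewrite (BS j).2 => /(_ i I) /=.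
        by rewrite tnth_vec.
      by move=> j _; rewrite (BS j).2 => i _ /=; rewrite tnth_vec; exact: (h (j, i)).
    rewrite (iX (fun p => B p.1 p.2)); last by move=> p; exact: (BS p.1).1.
    rewrite (eq_bigr (fun p => (fun j i => P (X (j, i) @^-1` B j i)) p.1 p.2)); last by case.
    rewrite -(pair_bigA _ (fun j i => P (X (j, i) @^-1` B j i)))/=.
    apply: eq_bigr => j _; rewrite (BS j).2 preimage_box.
    have ie : injective (fun i : 'I_n => (j, i)) by move=> i i' [].
    by rewrite (mutually_independent_inj ie iX (BS j).1).
  have [mk|km] := leqP m k.
    by apply: IH => // j kj; have := leq_trans (ltn_ord j) (leq_trans mk kj); rewrite ltnn.
  pose k' := Ordinal km.
  pose upd A j := if j == k' then A else S j.
  have mupd A : measurable A -> forall j, measurable (upd A j).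
    by move=> mA j; rewrite /upd; case: eqP.
  have bupd A : isbox A -> forall j : 'I_m, (k <= j)%N -> isbox (upd A j).
    move=> bA j kj; rewrite /upd; case: eqP => // jk; apply: bS.
    by rewrite ltn_neqAle kj andbT; apply/eqP => kj'; apply: jk; apply: val_inj.
  pose C := \bigcap_j (U j @^-1` upd setT j).
  have mC : measurable C.
    apply: fin_bigcap_measurable => // j _.
    by rewrite -[X in measurable X]setTI; apply: mU => //; exact: mupd.
  have updE A : \bigcap_j (U j @^-1` upd A j) = C `&` U k' @^-1` A.
    apply/seteqP; split => t /=.
      move=> h; split; last by have := h k' I; rewrite /= /upd eqxx.
      by move=> j _ /=; have := h j I; rewrite /= /upd; case: eqP.
    move=> [h At] j _ /=; have := h j I; rewrite /= /upd; case: eqP => // -> //.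
  have prodE A : (\prod_j P (U j @^-1` upd A j) =
      P (U k' @^-1` A) * \prod_(j | j != k') P (U j @^-1` S j))%E.
    rewrite (bigD1 k')//= {1}/upd eqxx; congr (_ * _)%E.
    by apply: eq_bigr => j /negbTE jk; rewrite /upd jk.
  have PC : P C = (\prod_(j | j != k') P (U j @^-1` S j))%E.
    rewrite (IH (upd setT)); [|exact: mupd|exact: bupd].
    by rewrite prodE preimage_setT probability_setT mul1e.
  have -> : S = upd (S k') by apply/funext => j; rewrite /upd; case: eqP => // ->.
  rewrite updE prodE -PC muleC; apply: vec_indep_event => // B mB.
  have bB : isbox (box B) by exists B.
  rewrite -preimage_box -/(U k') -updE (IH (upd (box B))).
  - by rewrite prodE -PC muleC.
  - by move=> j; apply: mupd; apply: isbox_meas.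
  - exact: (bupd _ bB).
move=> B mB.
have mfB j : measurable (f @^-1` B j).
  by rewrite -[X in measurable X]setTI; apply: mf.
apply: (indepU m (fun j => f @^-1` B j)) => // j mj.
by have := leq_trans (ltn_ord j) mj; rewrite ltnn.
Qed.

End independent_families.

(** * Gaussian quadratic forms *)

Section density.
Context {d : measure_display} {T : measurableType d} {R : realType}.
Variables (mu nu : {measure set T -> \bar R}) (p : T -> R).
Hypotheses (mp : measurable_fun setT p) (p0 : forall x, 0 <= p x).
Hypothesis nuE : forall A, measurable A -> nu A = (\int[mu]_(x in A) (p x)%:E)%E.

Import HBNNSimple.

Lemma integral_density_nnsfun (f : {nnsfun T >-> R}) :
  (\int[nu]_x (f x)%:E = \int[mu]_x ((f x)%:E * (p x)%:E))%E.
Proof.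
under [LHS]eq_integral do rewrite fimfunE -fsumEFin//.
rewrite [LHS]ge0_integral_fsum//; last 2 first.
  - by move=> r; exact/measurable_EFinP/measurableT_comp.
  - by move=> n x _; rewrite EFinM nnfun_muleindic_ge0.
transitivity (\int[mu]_x (\sum_(r \in range f) ((p x)%:E * (r * \1_(f @^-1` [set r]) x)%:E)))%E;
  last first.
  apply: eq_integral => x _; rewrite -ge0_mule_fsumr; last first.
    by move=> r; rewrite EFinM nnfun_muleindic_ge0.
  by rewrite muleC [in RHS]fimfunE -fsumEFin.
rewrite [RHS]ge0_integral_fsum//; last 2 first.
  - move=> r; apply: emeasurable_funM; first exact/measurable_EFinP.
    by apply/measurable_EFinP; do 2 apply/measurableT_comp => //.
  - by move=> n x _; apply: mule_ge0; [rewrite lee_fin|rewrite EFinM nnfun_muleindic_ge0].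
apply: eq_fsbigr => r _.
rewrite integralZl_indic_nnsfun// integral_indic// setIT nuE; last first.
  by rewrite -[X in measurable X]setTI; exact: measurable_funPT.
have [r0|r0] := ltP r 0.
  rewrite (_ : f @^-1` [set r] = set0) ?integral_set0 ?mule0.
    by rewrite integral0_eq// => x _; rewrite indicE in_set0 mulr0 mule0.
  apply/seteqP; split => x //= fxr.
  by have : 0 <= f x by []; rewrite fxr leNgt r0.
rewrite integral_mkcond -ge0_integralZl//.
- apply: eq_integral => x _; rewrite patchE indicE.
  by case: ifP => _; rewrite ?mulr1 ?mulr0 ?mule0 1?muleC.
- apply/(measurable_restrictT _ _).1 => //.
  apply/measurable_EFinP; exact: measurable_funTS.
- by move=> x _; rewrite erestrict_ge0// => y _; rewrite lee_fin.
Qed.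

Lemma ge0_integral_density (f : T -> \bar R) :
  measurable_fun setT f -> (forall x, 0 <= f x)%E ->
  (\int[nu]_x f x = \int[mu]_x (f x * (p x)%:E))%E.
Proof.
move=> mf f0.
pose f_ := nnsfun_approx measurableT mf.
have nd x a b : (a <= b)%N -> f_ a x <= f_ b x by move=> ab; exact/lefP/nd_nnsfun_approx.
transitivity (lim (\int[nu]_x (f_ n x)%:E @[n --> \oo])%E).
  rewrite -monotone_convergence//=.
  - apply: eq_integral => ? /[!inE] xD; apply/esym/cvg_lim => //=.
    exact: cvg_nnsfun_approx.
  - by move=> n; exact/measurable_EFinP/measurable_funTS.
  - by move=> n ? _; rewrite lee_fin.
  - by move=> ? _ ? ? mn; rewrite lee_fin nd.
transitivity (lim (\int[mu]_x ((f_ n x)%:E * (p x)%:E) @[n --> \oo])%E).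
  by apply: congr_lim; apply/funext => n /=; exact: integral_density_nnsfun.
rewrite -monotone_convergence//=.
- apply: eq_integral => x _; apply/cvg_lim => //.
  by apply: cvgeZr => //; exact: cvg_nnsfun_approx.
- by move=> n; apply: emeasurable_funM; exact/measurable_EFinP.
- by move=> n x _; rewrite mule_ge0 ?lee_fin.
- by move=> x _ a b ab; rewrite lee_wpmul2r ?lee_fin ?nd.
Qed.

End density.

Section gaussian_exponential.
Context {R : realType}.

Lemma integral_normal_expR (s al be : R) : 0 < s -> 2 * al * s ^+ 2 < 1 ->
  (\int[normal_prob 0 s]_x (expR (al * x ^+ 2 + be * x))%:E =
   (expR (s ^+ 2 * be ^+ 2 / (2 * (1 - 2 * al * s ^+ 2))) /
    Num.sqrt (1 - 2 * al * s ^+ 2))%:E)%E.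
Proof.
move=> s0 als; set w := 1 - 2 * al * s ^+ 2.
have w0 : 0 < w by rewrite /w subr_gt0.
have s_neq0 : s != 0 by rewrite gt_eqF.
have sw0 : 0 < Num.sqrt w by rewrite sqrtr_gt0.
have sw2 : Num.sqrt w ^+ 2 = w by rewrite sqr_sqrtr// ltW.
have mf : measurable_fun setT (fun x : R => (expR (al * x ^+ 2 + be * x))%:E).
  apply/measurable_EFinP; apply: measurableT_comp => //; apply: measurable_funD.
    by apply: measurable_funM => //; exact: measurable_funX.
  exact: measurable_funM.
rewrite (@ge0_integral_density _ _ _ lebesgue_measure _ _ (measurable_normal_pdf 0 s)
  (normal_pdf_ge0 0 s) _ _ mf)//.
(* Completing the square: the integrand times the density of [N(0, s^2)] is a constant times the
   density of [N(m', s'^2)], and the latter integrates to 1. *)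
pose s' := s / Num.sqrt w; pose m' := be * s ^+ 2 / w.
have s'0 : 0 < s' by rewrite divr_gt0.
have s'_neq0 : s' != 0 by rewrite gt_eqF.
set c := (X in _ = X%:E).
transitivity (\int[lebesgue_measure]_x (c%:E * (normal_pdf m' s' x)%:E))%E.
  apply: eq_integral => x _; rewrite -!EFinM; congr (_%:E).
  rewrite !normal_pdfE//.
  have peakE : normal_peak s' = Num.sqrt w * normal_peak s.
    rewrite /normal_peak /s' expr_div_n sw2.
    rewrite (_ : s ^+ 2 / w * pi *+ 2 = w^-1 * (s ^+ 2 * pi *+ 2)); last first.
      by rewrite -mulrnAr mulrC mulrA [RHS]mulrC; ring.
    by rewrite sqrtrM ?invr_ge0 ?(ltW w0)// sqrtrV ?(ltW w0)// invfM invrK.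
  rewrite peakE /normal_fun subr0 /c.
  have -> : expR (al * x ^+ 2 + be * x) * (normal_peak s * expR (- x ^+ 2 / (s ^+ 2 *+ 2))) =
    normal_peak s * expR (al * x ^+ 2 + be * x + - x ^+ 2 / (s ^+ 2 *+ 2)).
    by rewrite [in RHS]expRD; ring.
  have -> : al * x ^+ 2 + be * x + - x ^+ 2 / (s ^+ 2 *+ 2) =
     s ^+ 2 * be ^+ 2 / (2 * w) + - (x - m') ^+ 2 / (s' ^+ 2 *+ 2).
    rewrite /s' /m' expr_div_n sw2.
    have alE : al = (1 - w) / (2 * s ^+ 2) by rewrite /w; field.
    rewrite alE; field.
    by rewrite s_neq0 gt_eqF.
  by rewrite [in LHS]expRD; field; rewrite gt_eqF.
rewrite ge0_integralZl//.
- by rewrite integral_normal_pdf mule1.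
- by apply/measurable_EFinP; exact: measurable_normal_pdf.
- by move=> x _; rewrite lee_fin normal_pdf_ge0.
- by rewrite lee_fin divr_ge0// ?expR_ge0// sqrtr_ge0.
Qed.

End gaussian_exponential.

Lemma frob_outer_recl {R : realType} n (x : 'I_n.+1 -> R) (M : 'M[R]_n.+1) : M^T = M ->
  frob (outer x) M = M ord0 ord0 * x ord0 ^+ 2 +
    2 * (\sum_i M ord0 (lift ord0 i) * x (lift ord0 i)) * x ord0 +
    frob (outer (fun i => x (lift ord0 i))) (\matrix_(i, j) M (lift ord0 i) (lift ord0 j)).
Proof.
move=> sM; rewrite /frob big_ord_recl big_ord_recl !mxE.
under [X in _ + X]eq_bigr do rewrite big_ord_recl !mxE.
rewrite big_split/= !addrA; congr (_ + _); last first.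
  by apply: eq_bigr => i _; apply: eq_bigr => j _; rewrite !mxE.
rewrite -addrA; congr (_ + _); first by rewrite mulrC.
rewrite -big_split/= mulr_sumr mulr_suml; apply: eq_bigr => i _.
rewrite !mxE (_ : M (lift ord0 i) ord0 = M ord0 (lift ord0 i)); last by rewrite -[in LHS]sM mxE.
by ring.
Qed.

Lemma trace_recl {R : realType} n (M : 'M[R]_n.+1) :
  \tr M = M ord0 ord0 + \tr (\matrix_(i, j) M (lift ord0 i) (lift ord0 j)).
Proof.
rewrite /mxtrace big_ord_recl; congr (_ + _).
by apply: eq_bigr => i _; rewrite !mxE.
Qed.

Lemma frob_sqr_recl {R : realType} n (M : 'M[R]_n.+1) : M^T = M ->
  frob M M = M ord0 ord0 ^+ 2 + 2 * (\sum_i M ord0 (lift ord0 i) ^+ 2) +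
    frob (\matrix_(i, j) M (lift ord0 i) (lift ord0 j))
         (\matrix_(i, j) M (lift ord0 i) (lift ord0 j)).
Proof.
move=> sM; rewrite /frob big_ord_recl big_ord_recl.
under [X in _ + X]eq_bigr do rewrite big_ord_recl.
rewrite big_split/= !addrA; congr (_ + _); last first.
  by apply: eq_bigr => i _; apply: eq_bigr => j _; rewrite !mxE.
rewrite -addrA; congr (_ + _).
rewrite -big_split/= mulr_sumr; apply: eq_bigr => i _.
rewrite (_ : M (lift ord0 i) ord0 = M ord0 (lift ord0 i)); last by rewrite -[in LHS]sM mxE.
by ring.
Qed.

Lemma frob_ge0 {R : realType} n (M : 'M[R]_n) : 0 <= frob M M.
Proof. by apply: sumr_ge0 => i _; apply: sumr_ge0 => j _; rewrite -expr2 sqr_ge0. Qed.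

Lemma frobDr {R : realType} n (A B C : 'M[R]_n) : frob A (B + C) = frob A B + frob A C.
Proof.
rewrite /frob -big_split; apply: eq_bigr => i _; rewrite -big_split.
by apply: eq_bigr => j _; rewrite !mxE mulrDr.
Qed.

Lemma frobZr {R : realType} n c (A B : 'M[R]_n) : frob A (c *: B) = c * frob A B.
Proof.
rewrite /frob mulr_sumr; apply: eq_bigr => i _; rewrite mulr_sumr.
by apply: eq_bigr => j _; rewrite !mxE mulrCA.
Qed.

Lemma frobC {R : realType} n (A B : 'M[R]_n) : frob A B = frob B A.
Proof. by apply: eq_bigr => i _; apply: eq_bigr => j _; rewrite mulrC. Qed.

Lemma frob_outer_outer {R : realType} n (x y : 'I_n -> R) :
  frob (outer x) (outer y) = (\sum_i x i * y i) ^+ 2.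
Proof.
rewrite /frob expr2 mulr_suml; apply: eq_bigr => i _.
by rewrite mulr_sumr; apply: eq_bigr => j _; rewrite !mxE; ring.
Qed.

Lemma trace_outer {R : realType} n (x : 'I_n -> R) : \tr (outer x) = \sum_i x i ^+ 2.
Proof. by apply: eq_bigr => i _; rewrite mxE expr2. Qed.

(* Nonnegativity of the discriminant of [frob (A + t *: B) (A + t *: B)]. *)
Lemma frob_CauchySchwarz {R : realType} n (A B : 'M[R]_n) :
  frob A B ^+ 2 <= frob A A * frob B B.
Proof.
have q t : 0 <= frob A A + 2 * t * frob A B + t ^+ 2 * frob B B.
  have := frob_ge0 (A + t *: B).
  rewrite frobDr frobZr frobC frobDr frobZr [frob (A + _) B]frobC frobDr frobZr (frobC B A).
  by congr (_ <= _); ring.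
have [B0|Bneq0] := eqVneq (frob B B) 0.
  rewrite B0 mulr0; have [->|AB0] := eqVneq (frob A B) 0; first by rewrite expr0n.
  have := q (- (frob A A + 1) / (2 * frob A B)); rewrite B0 mulr0 addr0.
  have -> : 2 * (- (frob A A + 1) / (2 * frob A B)) * frob A B = - (frob A A + 1) by field.
  by move=> ?; lra.
have B0 : 0 < frob B B by rewrite lt_def Bneq0 frob_ge0.
have := q (- frob A B / frob B B).
have -> : frob A A + 2 * (- frob A B / frob B B) * frob A B +
    (- frob A B / frob B B) ^+ 2 * frob B B =
  (frob A A * frob B B - frob A B ^+ 2) / frob B B by field.
by rewrite pmulr_lge0 ?invr_gt0// subr_ge0.
Qed.

(** The logarithm of the middle term is [m + m^2 + O(m^3)]. The brackets 1/4 and 3 are those of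
    [gaussian_chaos_mgf], so that the diagonal entry integrated out matches its own share of the
    trace and of the Frobenius norm. *)
Lemma sqrt_inv_expR_bounds {R : realType} (m : R) : m ^+ 2 <= 100^-1 ->
  expR (m + m ^+ 2 / 4) <= (Num.sqrt (1 - 2 * m))^-1 <= expR (m + 3 * m ^+ 2).
Proof.
move=> m2; have m1 : m <= 10^-1 by nra.
have m1' : - 10^-1 <= m by nra.
have w0 : 0 < 1 - 2 * m by lra.
have sw0 : 0 < Num.sqrt (1 - 2 * m) by rewrite sqrtr_gt0.
have le1 (a b : R) : 0 <= a -> 0 <= b -> a ^+ 2 <= b ^+ 2 -> a <= b.
  by move=> a0 b0; rewrite ler_sqr ?nnegrE.
apply/andP; split; apply: le1; rewrite ?expR_ge0 ?invr_ge0 ?sqrtr_ge0//.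
- rewrite exprVn sqr_sqrtr ?(ltW w0)// -expRM_natl.
  rewrite -ler_pV2 ?invrK ?inE ?unitfE ?gt_eqF ?expR_gt0 ?invr_gt0//.
  rewrite -expRN; set z : R := 2%:R * (m + m ^+ 2 / 4).
  have -> : - z = 2%:R * (- (z / 2)) by field.
  rewrite expRM_natl.
  apply: (@le_trans _ _ ((1 + - (z / 2)) ^+ 2)); last first.
    rewrite ler_sqr ?nnegrE ?expR_ge0 ?expR_ge1Dx//.
    by rewrite /z; nra.
  have -> : (1 + - (z / 2)) ^+ 2 = 1 - 2 * m - m ^+ 2 / 2 + m ^+ 2 * (1 + m / 4) ^+ 2.
    by rewrite /z; field.
  suff : m ^+ 2 / 2 <= m ^+ 2 * (1 + m / 4) ^+ 2 by lra.
  by rewrite ler_wpM2l ?sqr_ge0//; nra.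
- rewrite exprVn sqr_sqrtr ?(ltW w0)// -expRM_natl.
  have -> : (1 - 2 * m)^-1 = 1 + 2 * m / (1 - 2 * m) by field; rewrite gt_eqF.
  apply: le_trans (expR_ge1Dx _) _; rewrite ler_expR.
  rewrite ler_pdivrMr//.
  suff : 0 <= m ^+ 2 * (2 - 12 * m) by nra.
  by rewrite mulr_ge0 ?sqr_ge0//; lra.
Qed.

Section gaussian_chaos.
Context {R : realType} {dT : measure_display} {T : measurableType dT}.
Variable P : probability T R.

Definition iid_normal n (s : R) (X : 'I_n -> T -> R) : Prop :=
  [/\ forall i, measurable_fun setT (X i), mutually_independent P X &
      forall i B, measurable B -> P (X i @^-1` B) = normal_prob 0 s B].

Lemma iid_normal_inj n p (s : R) (e : 'I_p -> 'I_n) (X : 'I_n -> T -> R) :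
  injective e -> iid_normal s X -> iid_normal s (fun i => X (e i)).
Proof.
move=> ie [mX iX lX]; split => [||i] /=; [by []|exact: (mutually_independent_inj ie iX)|exact: lX].
Qed.

Lemma expectation_iid_normal n s (X : 'I_n -> T -> R) i (f : R -> \bar R) :
  iid_normal s X -> measurable_fun setT f -> (forall x, 0 <= f x)%E ->
  (\int[P]_t f (X i t) = \int[normal_prob 0 s]_x f x)%E.
Proof.
move=> [mX _ lX] mf f0.
(* [normal_prob] is a measure on [measurableTypeR R], whose display is not that of [R]. *)
have mXi : @measurable_fun _ _ T (measurableTypeR R) setT (X i) by exact: mX.
have mf' : measurable_fun [set: measurableTypeR R] f by exact: mf.
pose U : {mfun T >-> measurableTypeR R} := @mfun_Sub _ _ T (measurableTypeR R) (X i) (mem_set mXi).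
have <- := @ge0_integral_distribution _ _ _ _ _ P U f mf' f0.
by apply: eq_measure_integral => A mA _; exact: lX.
Qed.

Lemma measurable_frob_outer n (M : 'M[R]_n) :
  measurable_fun [set: n.-tuple R] (fun v : n.-tuple R => frob (outer (tnth v)) M).
Proof.
apply: measurable_sum => i; apply: measurable_sum => j.
apply: measurable_funM => //.
rewrite [X in measurable_fun _ X](_ : _ = fun v : n.-tuple R => tnth v i * tnth v j); last first.
  by apply/funext => v; rewrite mxE.
by apply: measurable_funM; exact: measurable_tnth.
Qed.

(* Integrating out the first coordinate of [expR (s^-2 * Q)] gives [expR (s^-2 * Q')]
   up to a scalar, where [Q'] is the form in one variable less whose matrix is the
   minor of [M] plus the rank-one matrix [2 / (1 - 2 M00) u u^T]. *)
Lemma gaussian_chaos_mgf n s (X : 'I_n -> T -> R) (M : 'M[R]_n) : 0 < s ->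
  iid_normal s X -> M^T = M -> frob M M <= 100^-1 ->
  ((expR (\tr M + frob M M / 4))%:E <=
   \int[P]_t (expR (s ^- 2 * frob (outer (fun i => X i t)) M))%:E <=
   (expR (\tr M + 3 * frob M M))%:E)%E.
Proof.
move=> s0; elim: n X M => [|n IH] X M iX sM F1.
  have frob0 (A B : 'M[R]_0) : frob A B = 0 by rewrite /frob big_ord0.
  rewrite /mxtrace big_ord0 !frob0 mulr0 mul0r addr0 expR0.
  under eq_integral do rewrite frob0 mulr0 expR0.
  by rewrite integral_cst//= mul1e probability_setT !lexx.
have [mX indX lX] := iX.
set m := M ord0 ord0; pose u i := M ord0 (lift ord0 i).
pose M' : 'M[R]_n := \matrix_(i, j) M (lift ord0 i) (lift ord0 j).
pose X' i := X (lift ord0 i).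
have iX' : iid_normal s X' by apply: iid_normal_inj iX; exact: lift_inj.
have s_neq0 : s != 0 by rewrite gt_eqF.
have FE : frob M M = m ^+ 2 + 2 * (\sum_i u i ^+ 2) + frob M' M' by exact: frob_sqr_recl.
have trE : \tr M = m + \tr M' by exact: trace_recl.
set U := \sum_i u i ^+ 2 in FE.
have U0 : 0 <= U by apply: sumr_ge0 => i _; rewrite sqr_ge0.
have F'0 := frob_ge0 M'.
have m2 : m ^+ 2 <= 100^-1 by lra.
have m20 := sqr_ge0 m.
have m1 : m <= 10^-1 by nra.
have m1' : - 10^-1 <= m by nra.
have /andP[wlo wup] := sqrt_inv_expR_bounds m2.
set w := 1 - 2 * m in wlo wup.
have w0 : 0 < w by rewrite /w; lra.
have w_neq0 : w != 0 by rewrite gt_eqF.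
pose b := 2 / w.
pose M'' : 'M[R]_n := M' + b *: outer u.
have sM' : M'^T = M'.
  by apply/matrixP => i j; rewrite !mxE -[in LHS]sM mxE.
have sM'' : M''^T = M''.
  by rewrite /M'' linearD/= linearZ/= sM'; congr (_ + _ *: _); apply/matrixP => i j;
    rewrite !mxE mulrC.
have UE : U = \sum_i u i * u i by apply: eq_bigr => i _; rewrite expr2.
pose a := frob M' (outer u).
have a2 : a ^+ 2 <= frob M' M' * U ^+ 2.
  by rewrite /a UE -frob_outer_outer frob_CauchySchwarz.
have F''E : frob M'' M'' = frob M' M' + 2 * b * a + b ^+ 2 * U ^+ 2.
  rewrite /M'' frobDr frobZr frobC frobDr frobZr [frob (M' + _) _]frobC frobDr frobZr.
  rewrite (frobC (outer u) M') -/a frob_outer_outer.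
  rewrite -UE.
  by ring.
have tr''E : \tr M'' = \tr M' + b * U by rewrite linearD/= linearZ/= trace_outer.
have b1 : 5 / 3 <= b by rewrite /b ler_pdivlMr// /w; lra.
have b2 : b <= 5 / 2 by rewrite /b ler_pdivrMr// /w; lra.
have aU : - (U / 10) <= a <= U / 10.
  have : a ^+ 2 <= (U / 10) ^+ 2.
    apply: (le_trans a2); rewrite expr_div_n mulrC ler_wpM2l ?sqr_ge0//.
    by rewrite (_ : 10 ^+ 2 = 100); [lra|ring].
  by move=> h; apply/andP; split; nra.
have /andP[aU1 aU2] := aU.
have b0 : 0 <= b by lra.
have bU : b * U <= 5 / 2 * U by rewrite ler_wpM2r.
have ba1 : b * a <= U / 4.
  by apply: (@le_trans _ _ (b * (U / 10))); [rewrite ler_wpM2l|lra].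
have ba2 : - (U / 4) <= b * a.
  by apply: (@le_trans _ _ (b * - (U / 10))); [lra|rewrite ler_wpM2l].
have b2U2 : 0 <= b ^+ 2 * U ^+ 2 <= U / 32.
  rewrite mulr_ge0 ?sqr_ge0//=.
  apply: (@le_trans _ _ ((5 / 2) ^+ 2 * (U / 200))).
    by apply: ler_pM; rewrite ?sqr_ge0// ?ler_sqr ?nnegrE//; nra.
  by rewrite (_ : (5 / 2) ^+ 2 = 25 / 4 :> R); [lra|field].
have /andP[bU0 bU1] := b2U2.
(* Passing from [M] to the minor loses the off-diagonal weight [2 * U], and the rank-one term
   restores at most [U], so the smallness hypothesis survives the induction. The trace gains
   [b * U], between [5 / 3 * U] and [5 / 2 * U]: enough for the lower coefficient 1/4, and little
   enough for the upper coefficient 3. *)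
have F''lo : frob M' M' - U / 2 <= frob M'' M'' by rewrite F''E; lra.
have F''up : frob M'' M'' <= frob M' M' + U by rewrite F''E; lra.
have /andP[IHlo IHup] : ((expR (\tr M'' + frob M'' M'' / 4))%:E <=
   \int[P]_t (expR (s ^- 2 * frob (outer (fun i => X' i t)) M''))%:E <=
   (expR (\tr M'' + 3 * frob M'' M''))%:E)%E by apply: IH => //; lra.
pose l (v : n.-tuple R) := \sum_i u i * tnth v i.
have ml : measurable_fun setT l.
  by apply: measurable_sum => i; apply: measurable_funM => //; exact: measurable_tnth.
have mQ' := measurable_frob_outer M'.
pose f (z : n.-tuple R * R) : \bar R :=
  (expR (s ^- 2 * (m * z.2 ^+ 2 + 2 * l z.1 * z.2 + frob (outer (tnth z.1)) M')))%:E.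
have mf : measurable_fun setT f.
  apply/measurable_EFinP; apply: measurableT_comp => //; apply: measurable_funM => //.
  apply: measurable_funD; last exact: measurableT_comp mQ' _.
  apply: measurable_funD; first by apply: measurable_funM => //; apply: measurable_funX.
  apply: measurable_funM => //; apply: measurable_funM => //.
  exact: (measurableT_comp ml).
have -> : (\int[P]_t (expR (s ^- 2 * frob (outer (fun i => X i t)) M))%:E =
    (Num.sqrt w)^-1%:E * \int[P]_t (expR (s ^- 2 * frob (outer (fun i => X' i t)) M''))%:E)%E.
  transitivity (\int[P]_t f (vec X' t, X ord0 t))%E.
    apply: eq_integral => t _; rewrite /f/= tnth_vec frob_outer_recl//.
    rewrite (_ : l _ = \sum_i M ord0 (lift ord0 i) * X (lift ord0 i) t)//.
    by apply: eq_bigr => i _; rewrite tnth_vec.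
  rewrite expectation_head_tonelli//; last by move=> z; rewrite lee_fin expR_ge0.
  rewrite -ge0_integralZl//; last first.
  - apply/measurable_EFinP; apply: measurableT_comp => //; apply: measurable_funM => //.
    rewrite [X in measurable_fun _ X](_ : _ =
      (fun v : n.-tuple R => frob (outer (tnth v)) M'') \o vec X').
      apply: measurableT_comp; first exact: measurable_frob_outer.
      by apply: measurable_vec => i; exact: mX.
    by apply/funext => t /=; rewrite tnth_vec.
  apply: eq_integral => t _.
  pose lt := l (vec X' t).
  have ltE : lt = \sum_i u i * X' i t by apply: eq_bigr => i _; rewrite tnth_vec.
  have Q''E : frob (outer (fun i => X' i t)) M'' =
      frob (outer (fun i => X' i t)) M' + b * lt ^+ 2.
    rewrite /M'' frobDr frobZr frob_outer_outer ltE; congr (_ + _ * _ ^+ 2).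
    by apply: eq_bigr => i _; rewrite mulrC.
  pose h (x : R) := (expR (m / s ^+ 2 * x ^+ 2 + (2 * lt / s ^+ 2) * x))%:E.
  have mh : measurable_fun setT h.
    apply/measurable_EFinP; apply: measurableT_comp => //; apply: measurable_funD.
      by apply: measurable_funM => //; exact: measurable_funX.
    exact: measurable_funM.
  transitivity (\int[P]_x ((expR (s ^- 2 * frob (outer (fun i => X' i t)) M'))%:E * h (X ord0 x)))%E.
    apply: eq_integral => x _; rewrite /h/f/= -EFinM -expRD tnth_vec -/lt; congr (expR _)%:E.
    by field.
  rewrite ge0_integralZl; [|by []|exact: (measurableT_comp mh (mX ord0))
    |by move=> x _; rewrite lee_fin expR_ge0|by rewrite lee_fin expR_ge0].
  rewrite (expectation_iid_normal ord0 iX)//; last by move=> x; rewrite lee_fin expR_ge0.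
  (* The linear coefficient [2 * lt / s^2] contributes [s^2 * (2 * lt / s^2)^2 / (2 * w) = s^-2 * b
     * lt^2] to the exponent, which is exactly the rank-one term of [M'']. *)
  have wE : 1 - 2 * (m / s ^+ 2) * s ^+ 2 = w by rewrite /w; field.
  rewrite /h integral_normal_expR//; last by rewrite -subr_gt0 wE.
  rewrite wE -!EFinM; congr _%:E.
  rewrite mulrA -expRD mulrC; congr (_ * expR _).
  by rewrite Q''E /b; field; rewrite w_neq0 s_neq0.
have wi0 : 0 < (Num.sqrt w)^-1 by rewrite invr_gt0 sqrtr_gt0.
apply/andP; split.
- apply: (@le_trans _ _ ((Num.sqrt w)^-1%:E * (expR (\tr M'' + frob M'' M'' / 4))%:E)%E);
    last by rewrite lee_pmul2l.
  rewrite -EFinM lee_fin.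
  apply: (@le_trans _ _ (expR (m + m ^+ 2 / 4) * expR (\tr M'' + frob M'' M'' / 4)));
    last by rewrite ler_wpM2r ?expR_ge0.
  rewrite -expRD ler_expR tr''E trE FE.
  suff : U / 2 <= b * U - U / 8 by lra.
  by nra.
- apply: (@le_trans _ _ ((Num.sqrt w)^-1%:E * (expR (\tr M'' + 3 * frob M'' M''))%:E)%E);
    first by rewrite lee_pmul2l.
  rewrite -EFinM lee_fin.
  apply: (@le_trans _ _ (expR (m + 3 * m ^+ 2) * expR (\tr M'' + 3 * frob M'' M'')));
    first by rewrite ler_wpM2r ?expR_ge0.
  rewrite -expRD ler_expR tr''E trE FE.
  lra.
Qed.

End gaussian_chaos.

Section expectation_tools.
Context {R : realType} {dT : measure_display} {T : measurableType dT}.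
Variable P : probability T R.
Implicit Types f g : T -> R.

Lemma expect_cst c : (\int[P]_t (c : R)%:E = c%:E)%E.
Proof. by rewrite integral_cst//= probability_setT mule1. Qed.

Lemma expect_le f g : measurable_fun setT f -> measurable_fun setT g ->
  (forall t, 0 <= f t <= g t) -> (\int[P]_t (f t)%:E <= \int[P]_t (g t)%:E)%E.
Proof.
move=> mf mg fg; apply: ge0_le_integral => //.
- by move=> t _; rewrite lee_fin; have /andP[] := fg t.
- exact/measurable_EFinP.
- exact/measurable_EFinP.
- by move=> t _; rewrite lee_fin; have /andP[] := fg t.
Qed.

Lemma expectD f g : measurable_fun setT f -> measurable_fun setT g ->
  (forall t, 0 <= f t) -> (forall t, 0 <= g t) ->
  (\int[P]_t (f t + g t)%:E = \int[P]_t (f t)%:E + \int[P]_t (g t)%:E)%E.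
Proof.
move=> mf mg f0 g0; under eq_integral do rewrite EFinD.
rewrite ge0_integralD//.
- by move=> t _; rewrite lee_fin.
- exact/measurable_EFinP.
- by move=> t _; rewrite lee_fin.
- exact/measurable_EFinP.
Qed.

Lemma expectZ k f : measurable_fun setT f -> (forall t, 0 <= f t) -> 0 <= k ->
  (\int[P]_t (k * f t)%:E = k%:E * \int[P]_t (f t)%:E)%E.
Proof.
move=> mf f0 k0; under eq_integral do rewrite EFinM.
rewrite ge0_integralZl//.
- exact/measurable_EFinP.
- by move=> t _; rewrite lee_fin.
Qed.

(** Names a dominated integral by a real number, so that the later estimates become real
    arithmetic. *)
Lemma expect_real f g K : measurable_fun setT f -> measurable_fun setT g ->
  (forall t, 0 <= f t <= g t) -> (\int[P]_t (g t)%:E <= K%:E)%E ->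
  exists2 v, (\int[P]_t (f t)%:E = v%:E)%E & 0 <= v <= K.
Proof.
move=> mf mg fg gK.
have f0 : (0 <= \int[P]_t (f t)%:E)%E.
  by apply: integral_ge0 => t _; rewrite lee_fin; have /andP[] := fg t.
have fK := le_trans (expect_le mf mg fg) gK.
have ffin : (\int[P]_t (f t)%:E \is a fin_num)%E.
  by rewrite ge0_fin_numE//; apply: le_lt_trans fK (ltry _).
exists (fine (\int[P]_t (f t)%:E)%E); first by rewrite fineK.
by rewrite -!lee_fin fineK// f0.
Qed.

End expectation_tools.

(** * Elementary inequalities for the exponential *)

Section real_inequalities.
Context {R : realType}.
Implicit Types x y : R.

Lemma le_expR_id x : x <= expR x.
Proof. by apply: le_trans (expR_ge1Dx x); rewrite lerDr. Qed.

Lemma expR_le_inv x : x < 1 -> expR x <= (1 - x)^-1.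
Proof.
move=> x1; have x0 : 0 < 1 - x by lra.
rewrite -[leLHS]invrK lef_pV2 ?posrE ?invr_gt0 ?expR_gt0//.
by rewrite -expRN; exact: expR_ge1Dx.
Qed.

Lemma expR_norm_le x : expR `|x| <= expR x + expR (- x).
Proof.
have [x0|x0] := ger0P x.
  by rewrite lerDl expR_ge0.
by rewrite lerDr expR_ge0.
Qed.

Lemma expR_norm_sum x : expR x + expR (- x) = expR `|x| + expR (- `|x|).
Proof. by have [x0|x0] := ger0P x; rewrite // opprK addrC. Qed.

(** With [y = |x|], the right side minus 2 is the square of [expR (y / 2) - expR (- (y / 2))], which
    is at least [y / 2]. *)
Lemma cosh_ge x : 2 + x ^+ 2 / 4 <= expR x + expR (- x).
Proof.
rewrite expR_norm_sum -[x ^+ 2]real_normK ?num_real//.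
have := normr_ge0 x; move: `|x| => y y0.
have yy : expR (- (y / 2)) <= (1 + y / 2)^-1.
  by rewrite expRN lef_pV2 ?posrE ?expR_gt0 ?expR_ge1Dx//; lra.
have y2 : 1 + y / 2 <= expR (y / 2) by exact: expR_ge1Dx.
have e (z : R) : expR z = expR (z / 2) ^+ 2.
  by rewrite -expRM_natl; congr expR; field.
have ee : expR (y / 2) * expR (- (y / 2)) = 1 by rewrite -expRD subrr expR0.
rewrite (e y) (e (- y)) mulNr.
suff : y / 2 <= expR (y / 2) - expR (- (y / 2)) by nra.
have : y / 2 <= (1 + y / 2) - (1 + y / 2)^-1.
  rewrite (_ : _ - _ = y / 2 * (2 + y / 2) / (1 + y / 2)); last by field; lra.
  by rewrite ler_pdivlMr; nra.
lra.
Qed.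

(** Truncation at [expR x = A]: below, [expR x - 1 <= x * expR x <= A * x]; above,
    [expR x <= A^-1 * expR x ^+ 2]. In the mean this trades an exponential lower bound for one on
    the first moment. *)
Lemma expR_sub1_le (A x : R) : 0 < A -> 0 <= x ->
  expR x - 1 <= A * x + A^-1 * expR (2 * x).
Proof.
move=> A0 x0; have e0 := expR_gt0 x.
have -> : expR (2 * x) = expR x ^+ 2 by rewrite -expRM_natl.
have [eA|Ae] := leP (expR x) A.
  have : expR x - 1 <= x * expR x.
    have := expR_ge1Dx (- x); rewrite expRN.
    have : expR x * (expR x)^-1 = 1 by rewrite divff// gt_eqF.
    nra.
  have : x * expR x <= A * x by rewrite mulrC ler_wpM2r.
  have : 0 <= A^-1 * expR x ^+ 2 by rewrite mulr_ge0 ?invr_ge0 ?sqr_ge0// ltW.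
  lra.
have : expR x <= A^-1 * expR x ^+ 2.
  by rewrite ler_pdivlMl// expr2 ler_wpM2r// ltW.
have : 0 <= A * x by rewrite mulr_ge0// ltW.
lra.
Qed.

(** Here [t] is the trace part and [f] the Frobenius part of a form of normalised scale. The product
    [(2 + t^2 / 4) * (1 + f / 4)] exceeds 2 by at least [(t^2 + f) / 4], whichever part
    dominates. *)
Lemma cosh_expR_lower (t f : R) : 0 <= f -> t ^+ 2 + f = 400^-1 ->
  2 + 1 / 1600 <= expR (t + f / 4) + expR (- t + f / 4).
Proof.
move=> f0 tf; rewrite !expRD -mulrDl.
have t0 := sqr_ge0 t; have ht := cosh_ge t; have hf := expR_ge1Dx (f / 4).
apply: (@le_trans _ _ ((2 + t ^+ 2 / 4) * (1 + f / 4))).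
  have : 0 <= t ^+ 2 * f by exact: mulr_ge0.
  by lra.
by apply: ler_pM => //; lra.
Qed.

(** The truncation level 9600 makes the error [3 / 9600] half of the gain [1 / 1600]; the other
    half, [1 / 3200], must come from [9600 * v]. *)
Lemma gauss_const_aux (v e : R) : e <= 3 ->
  2 + 1 / 1600 <= 2 + (9600 * v + 9600^-1 * e) -> 3200^-1 / 9600 <= v.
Proof.
have [A AE] : exists A : R, A = 9600 by exists 9600.
have A0 : 0 < A by rewrite AE ltr0n.
rewrite -AE => e3 main; rewrite ler_pdivrMr; last exact: A0.
have : A^-1 * e <= 3200^-1 by rewrite ler_pdivrMl// AE; lra.
by move=> ?; lra.
Qed.

End real_inequalities.

(** * Moments of the normalised Gaussian form *)

Section chaos_moments.
Context {R : realType} {dT : measure_display} {T : measurableType dT}.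
Variable P : probability T R.

Lemma measurable_chaos n (h : 'I_n -> T -> R) (M : 'M[R]_n) :
  (forall i, measurable_fun setT (h i)) ->
  measurable_fun setT (fun t => frob (outer (fun i => h i t)) M).
Proof.
move=> mh; rewrite [X in measurable_fun _ X](_ : _ =
    (fun v : n.-tuple R => frob (outer (tnth v)) M) \o vec h).
  by apply: measurableT_comp; [exact: measurable_frob_outer|exact: measurable_vec].
by apply/funext => t /=; rewrite tnth_vec.
Qed.

Lemma frobZl n c (A B : 'M[R]_n) : frob (c *: A) B = c * frob A B.
Proof. by rewrite frobC frobZr frobC. Qed.

Lemma symmetricZ n c (A : 'M[R]_n) : A^T = A -> (c *: A)^T = c *: A.
Proof. by move=> sA; rewrite linearZ/= sA. Qed.

Variables (n : nat) (s : R) (h : 'I_n -> T -> R) (M : 'M[R]_n).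
Hypotheses (s0 : 0 < s) (ih : iid_normal P s h) (sM : M^T = M).

Let sigma2 := \tr M ^+ 2 + frob M M.
Let sigma := Num.sqrt sigma2.
Hypothesis sigma2_gt0 : 0 < sigma2.

Let Q t := frob (outer (fun i => h i t)) M.
(** The factor [s ^- 2] reduces to standard coordinates. The 20 puts [2 * chaos] at the coefficient
    [c = 1 / (10 * sigma)], for which [c^2 * sigma2 = 1 / 100] is the threshold of
    [gaussian_chaos_mgf]. *)
Definition chaos t := s ^- 2 * `|Q t| / (20 * sigma).

Let mh i : measurable_fun setT (h i). Proof. by case: ih. Qed.
Let mQ : measurable_fun setT Q. Proof. exact: measurable_chaos. Qed.
Let sg0 : 0 < sigma. Proof. by rewrite sqrtr_gt0. Qed.
Let sg2 : sigma ^+ 2 = sigma2. Proof. by rewrite sqr_sqrtr// ltW. Qed.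
Let s20 : 0 < s ^- 2. Proof. by rewrite invr_gt0 exprn_gt0. Qed.

Lemma chaos_ge0 t : 0 <= chaos t.
Proof. by rewrite /chaos divr_ge0// mulr_ge0// ltW. Qed.

Lemma measurable_abs_chaos : measurable_fun setT chaos.
Proof.
apply: measurable_funM => //; apply: measurable_funM => //.
exact: measurableT_comp.
Qed.

Let measurable_expR_scale c : measurable_fun setT (fun t => expR (c * Q t)).
Proof. by apply: measurableT_comp => //; apply: measurable_funM. Qed.

Let chaos_mgf c : c ^+ 2 * sigma2 <= 100^-1 ->
  ((expR (c * \tr M + c ^+ 2 * frob M M / 4))%:E <=
   \int[P]_t (expR (s ^- 2 * c * Q t))%:E <=
   (expR (c * \tr M + 3 * (c ^+ 2 * frob M M)))%:E)%E.
Proof.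
move=> c1.
have F1 : frob (c *: M) (c *: M) = c ^+ 2 * frob M M by rewrite frobZl frobZr; ring.
have := gaussian_chaos_mgf s0 ih (symmetricZ c sM).
rewrite F1 linearZ/= => /(_ _)/wrap[].
  by apply: le_trans c1; rewrite ler_wpM2l ?sqr_ge0// /sigma2 lerDr sqr_ge0.
by under eq_integral do rewrite frobZr mulrA.
Qed.

(** The exponential of an absolute value is at most the sum of the two signed exponentials. Each has
    mean at most [expR (1 / 10 + 3 / 100) <= 100 / 87 <= 3 / 2]. *)
Lemma chaos_expR2_le3 : (\int[P]_t (expR (2 * chaos t))%:E <= 3%:E)%E.
Proof.
have c1 (c : R) : c ^+ 2 = (10 * sigma) ^- 2 -> c ^+ 2 * sigma2 <= 100^-1.
  move=> ->; rewrite -sg2 exprMn (_ : 10 ^+ 2 = 100); last by ring.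
  by rewrite le_eqVlt; apply/orP; left; apply/eqP; field; rewrite gt_eqF.
have up (c : R) : c ^+ 2 = (10 * sigma) ^- 2 ->
    (\int[P]_t (expR (s ^- 2 * c * Q t))%:E <= (3 / 2)%:E)%E.
  move=> cE; have /andP[_ ub] := chaos_mgf (c1 _ cE).
  apply: (le_trans ub); rewrite lee_fin.
  have c2 := c1 _ cE.
  have c2F : c ^+ 2 * frob M M <= 100^-1.
    by apply: le_trans c2; rewrite ler_wpM2l ?sqr_ge0// /sigma2 lerDr sqr_ge0.
  have ct : c * \tr M <= 10^-1.
    have : (c * \tr M) ^+ 2 <= 100^-1.
      rewrite exprMn; apply: le_trans c2.
      by rewrite ler_wpM2l ?sqr_ge0// /sigma2 lerDl frob_ge0.
    nra.
  apply: (@le_trans _ _ (expR (13 / 100))); first by rewrite ler_expR; lra.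
  apply: (@le_trans _ _ (1 - 13 / 100)^-1); first by apply: expR_le_inv; lra.
  by rewrite (_ : (1 - 13 / 100)^-1 = 100 / 87); [lra|field].
have cE1 : ((10 * sigma)^-1) ^+ 2 = (10 * sigma) ^- 2 by rewrite exprVn.
have cE2 : (- (10 * sigma)^-1) ^+ 2 = (10 * sigma) ^- 2 by rewrite sqrrN exprVn.
have := leeD (up _ cE1) (up _ cE2).
rewrite -expectD//; try by move=> t; exact: expR_ge0.
have -> : ((3 / 2)%:E + (3 / 2)%:E = 3%:E :> \bar R)%E by rewrite -EFinD; congr _%:E; field.
apply: le_trans; apply: expect_le => //.
- apply: measurableT_comp => //; apply: measurable_funM => //; exact: measurable_abs_chaos.
- by apply: measurable_funD.
- move=> t; rewrite expR_ge0/=.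
  have -> : 2 * chaos t = `|s ^- 2 * (10 * sigma)^-1 * Q t|.
    rewrite !normrM (gtr0_norm s20) (gtr0_norm (_ : 0 < (10 * sigma)^-1)) ?invr_gt0 ?mulr_gt0//.
    rewrite /chaos; field; rewrite !gt_eqF//.
  apply: (le_trans (expR_norm_le _)).
  by rewrite mulrN mulNr.
Qed.

Definition gauss_const : R := 3200^-1 / 9600.

Lemma gauss_const_gt0 : 0 < gauss_const. Proof. by rewrite divr_gt0 ?invr_gt0 ?ltr0n. Qed.

(** The lower Laplace bounds at [c] and [- c], [c = 1 / (20 * sigma)], sum to at least
    [2 + 1 / 1600]; both signs are taken so that the sign of the trace does not matter. Pointwise
    the same sum is at most [2 + A * chaos + A^-1 * expR (2 * chaos)], whose last term has mean at
    most [3 / A]. *)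
Lemma chaos_mean_ge : (gauss_const%:E <= \int[P]_t (chaos t)%:E)%E.
Proof.
have c1 (c : R) : c ^+ 2 = (20 * sigma) ^- 2 -> c ^+ 2 * sigma2 = 400^-1.
  move=> ->; rewrite -sg2 exprMn (_ : 20 ^+ 2 = 400); last by ring.
  by field; rewrite gt_eqF.
pose c := (20 * sigma)^-1.
have cE1 : c ^+ 2 = (20 * sigma) ^- 2 by rewrite exprVn.
have cE2 : (- c) ^+ 2 = (20 * sigma) ^- 2 by rewrite sqrrN exprVn.
have le4 : 400^-1 <= 100^-1 :> R by lra.
have /andP[lo1 _] : _ := chaos_mgf (eq_ind_r (fun x => x <= _) le4 (c1 _ cE1)).
have /andP[lo2 _] : _ := chaos_mgf (eq_ind_r (fun x => x <= _) le4 (c1 _ cE2)).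
have := leeD lo1 lo2.
rewrite -expectD//; try by move=> t; exact: expR_ge0.
move=> lo.
have mV := measurable_abs_chaos.
have me : measurable_fun setT (fun t => expR (2 * chaos t)).
  by apply: measurableT_comp => //; apply: measurable_funM.
have e0 t : 0 <= expR (2 * chaos t) by exact: expR_ge0.
have [v vE v0] : exists2 v, (\int[P]_t (chaos t)%:E = v%:E)%E & 0 <= v <= 3.
  apply: expect_real chaos_expR2_le3 => // t.
  rewrite chaos_ge0/=; apply: le_trans (le_expR_id _) _; rewrite ler_expR.
  by have := chaos_ge0 t; lra.
have [e eE eb] := expect_real me me (fun t => introT andP (conj (e0 t) (lexx _))) chaos_expR2_le3.
rewrite vE lee_fin.
have [A AE] : exists A : R, A = 9600 by exists 9600.
have A0 : 0 < A by rewrite AE ltr0n.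
have bound : (\int[P]_t (2 + (A * chaos t + A^-1 * expR (2 * chaos t)))%:E =
   (2 + (A * v + A^-1 * e))%:E)%E.
  have m1 : measurable_fun setT (fun t => A * chaos t) by apply: measurable_funM.
  have m2 : measurable_fun setT (fun t => A^-1 * expR (2 * chaos t)).
    by apply: measurable_funM.
  have p1 t : 0 <= A * chaos t by rewrite mulr_ge0 ?chaos_ge0 ?ltW.
  have p2 t : 0 <= A^-1 * expR (2 * chaos t) by rewrite mulr_ge0// invr_ge0 ltW.
  rewrite (@expectD _ _ _ P (fun=> 2))//; last 2 first.
  - exact: measurable_funD.
  - by move=> t; exact: addr_ge0.
  have Ai0 : 0 <= A^-1 by rewrite invr_ge0 ltW.
  rewrite (expectD P m1 m2 p1 p2) (expectZ _ mV chaos_ge0 (ltW A0)) (expectZ _ me e0 Ai0).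
  by rewrite vE eE expect_cst.
have : (\int[P]_t (expR (s ^- 2 * c * Q t) + expR (s ^- 2 * - c * Q t))%:E <=
   (2 + (A * v + A^-1 * e))%:E)%E.
  rewrite -bound; apply: expect_le.
  - exact: measurable_funD.
  - apply: measurable_funD => //; apply: measurable_funD; exact: measurable_funM.
  - move=> t; rewrite addr_ge0 ?expR_ge0//=.
    rewrite mulrN mulNr expR_norm_sum.
    have -> : `|s ^- 2 * c * Q t| = chaos t.
      rewrite !normrM (gtr0_norm s20) (gtr0_norm (_ : 0 < c)) ?invr_gt0 ?mulr_gt0//.
      by rewrite /chaos /c; ring.
    have := expR_sub1_le A0 (chaos_ge0 t).
    have : expR (- chaos t) <= 1 by rewrite -expR0 ler_expR oppr_le0 chaos_ge0.
    by lra.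
move=> /(le_trans lo); rewrite -EFinD lee_fin => main.
have c2F0 : 0 <= c ^+ 2 * frob M M by rewrite mulr_ge0 ?sqr_ge0 ?frob_ge0.
have cM : (c * \tr M) ^+ 2 + c ^+ 2 * frob M M = 400^-1.
  by rewrite exprMn -mulrDr; exact: c1.
have := cosh_expR_lower c2F0 cM; rewrite -mulNr -{2}(sqrrN c) => lower.
have /andP[_ e3] := eb.
by apply: (gauss_const_aux e3); rewrite -AE; exact: le_trans lower main.
Qed.

End chaos_moments.

Section square_norm.
Context {R : realType} {dT : measure_display} {T : measurableType dT}.
Variable P : probability T R.

Lemma mutually_independent_comp (I : finType) (X : I -> T -> R) (f : R -> R) :
  measurable_fun setT f -> mutually_independent P X ->
  mutually_independent P (fun i t => f (X i t)).
Proof.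
move=> mf iX B mB; apply: (iX (fun i => f @^-1` B i)) => i.
by rewrite -[X in measurable X]setTI; apply: mf.
Qed.

Variables (n : nat) (s : R) (h : 'I_n -> T -> R).
Hypotheses (s0 : 0 < s) (ih : iid_normal P s h).

Definition sqn (x : 'I_n -> R) := \sum_i x i ^+ 2.

Lemma sqn_ge0 x : 0 <= sqn x.
Proof. by apply: sumr_ge0 => i _; rewrite sqr_ge0. Qed.

Let mh i : measurable_fun setT (h i). Proof. by case: ih. Qed.

Lemma measurable_sqn : measurable_fun setT (fun t => sqn (fun i => h i t)).
Proof. by apply: measurable_sum => i; apply: measurable_funX. Qed.

Let s_neq0 : s != 0. Proof. by rewrite gt_eqF. Qed.

Let measurable_expR_sqr (c : R) : measurable_fun setT (fun x : R => expR (c * x ^+ 2)).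
Proof.
by apply: measurableT_comp => //; apply: measurable_funM => //; apply: measurable_funX.
Qed.

Lemma expect_expR_sqr c i : 2 * c * s ^+ 2 < 1 ->
  (\int[P]_t (expR (c * h i t ^+ 2))%:E = ((Num.sqrt (1 - 2 * c * s ^+ 2))^-1)%:E)%E.
Proof.
move=> cs.
rewrite (@expectation_iid_normal _ _ _ _ _ _ _ i (fun x => (expR (c * x ^+ 2))%:E) ih).
- have := @integral_normal_expR R s c 0 s0 cs.
  rewrite expr0n/= mulr0 mul0r expR0 mul1r => <-.
  by apply: eq_integral => x _; rewrite mul0r addr0.
- exact/measurable_EFinP.
- by move=> x; rewrite lee_fin expR_ge0.
Qed.

Lemma expect_expR_neg_sqn c : 0 <= c ->
  (\int[P]_t (expR (- c * sqn (fun i => h i t)))%:E =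
   ((Num.sqrt (1 + 2 * c * s ^+ 2))^-1 ^+ n)%:E)%E.
Proof.
move=> c0; have [_ iX _] := ih.
have cs0 : 0 <= 2 * c * s ^+ 2 by rewrite mulr_ge0 ?sqr_ge0// mulr_ge0.
transitivity (\int[P]_t (\prod_i expR (- c * h i t ^+ 2))%:E)%E.
  by apply: eq_integral => t _; rewrite /sqn mulr_sumr expR_sum.
rewrite expectation_prod.
- under eq_bigr => i _.
    rewrite expect_expR_sqr; last first.
      by rewrite mulrN mulNr; apply: le_lt_trans ltr01; rewrite oppr_le0.
    over.
  by rewrite prodEFin prodr_const card_ord mulrN mulNr opprK.
- by move=> i; apply: (measurableT_comp (measurable_expR_sqr (- c)) (mh i)).
- exact: (mutually_independent_comp (measurable_expR_sqr (- c)) iX).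
- by move=> i t; exact: expR_ge0.
Qed.

Lemma expect_sqn_le : (\int[P]_t (sqn (fun i => h i t))%:E <= (n%:R * (6 * s ^+ 2))%:E)%E.
Proof.
have s20 : 0 < s ^+ 2 by rewrite exprn_gt0.
rewrite /sqn; under eq_integral do rewrite -sumEFin.
rewrite ge0_integral_sum//; last 2 first.
- by move=> i; apply/measurable_EFinP; exact: measurable_funX.
- by move=> i t _; rewrite lee_fin sqr_ge0.
rewrite mulr_natl -[X in _ *+ X]card_ord -sumr_const -sumEFin; apply: lee_sum => i _.
(* A crude bound suffices: [x^2 <= 4 * s^2 * expR (c * x^2)], and this exponential has mean
   [sqrt 2 <= 3 / 2], whence [6 * s^2] per coordinate. *)
pose c := (4 * s ^+ 2)^-1.
have c0 : 0 < c by rewrite invr_gt0 mulr_gt0.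
have cE : 2 * c * s ^+ 2 = 1 / 2 by rewrite /c; field.
have m2 : measurable_fun setT (fun t => expR (c * h i t ^+ 2)).
  exact: (measurableT_comp (measurable_expR_sqr c) (mh i)).
apply: (@le_trans _ _ (\int[P]_t (4 * s ^+ 2 * expR (c * h i t ^+ 2))%:E)%E).
  apply: expect_le => //.
  - exact: measurable_funX.
  - exact: measurable_funM.
  - move=> t; rewrite sqr_ge0/= -ler_pdivrMl ?mulr_gt0//.
    exact: le_expR_id.
rewrite expectZ//; last by rewrite mulr_ge0 ?(ltW s20).
rewrite expect_expR_sqr; last by rewrite cE; lra.
rewrite -EFinM lee_fin cE.
have -> : 6 * s ^+ 2 = 4 * s ^+ 2 * (3 / 2) by field.
apply: ler_wpM2l; first by rewrite mulr_ge0 ?(ltW s20).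
have sq23 : 2 / 3 <= Num.sqrt (1 - 1 / 2 : R).
  rewrite -[leLHS]ger0_norm; last by lra.
  by rewrite -sqrtr_sqr ler_sqrt; [rewrite expr_div_n; lra|lra].
rewrite -[leRHS]invrK lef_pV2 ?posrE ?invr_gt0 ?invf_div//; try lra.
Qed.

End square_norm.

(** * Comparison of the spherical form with the Gaussian one *)

Section spherical_chaos.
Context {R : realType} {dT : measure_display} {T : measurableType dT}.
Variable P : probability T R.
Variables (n : nat) (s : R) (h : 'I_n -> T -> R) (M : 'M[R]_n).
Hypotheses (s0 : 0 < s) (ih : iid_normal P s h) (sM : M^T = M) (sn : s ^- 2 = n%:R).
Hypothesis M_gt0 : 0 < \tr M ^+ 2 + frob M M.

Let N t := sqn (fun i => h i t).
Let V := chaos s h M.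
Let N0 t : 0 <= N t. Proof. exact: sqn_ge0. Qed.
Let V0 t : 0 <= V t. Proof. exact: chaos_ge0. Qed.
Let mN : measurable_fun setT N. Proof. exact: measurable_sqn ih. Qed.
Let mV : measurable_fun setT V. Proof. exact: measurable_abs_chaos ih. Qed.

(** The form is homogeneous of degree 2, so the quotient is its value at the normalised vector, in
    the same units. At the zero vector it is 0. *)
Definition sphere_chaos t := chaos s h M t / sqn (fun i => h i t).

Lemma sphere_chaos_ge0 t : 0 <= sphere_chaos t.
Proof. by rewrite divr_ge0// ?chaos_ge0// sqn_ge0. Qed.

Lemma measurable_sphere_chaos : measurable_fun setT sphere_chaos.
Proof.
apply: measurable_funM => //.
rewrite [X in measurable_fun _ X](_ : _ = (fun x => x `^ (-1)) \o N).
  exact: measurableT_comp.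
by apply/funext => t /=; rewrite powR_inv1.
Qed.

(** Cauchy-Schwarz for the Frobenius product, with [|M|_F <= sigma]. It bounds the spherical form
    everywhere and makes the Gaussian one vanish with the vector. *)
Lemma chaos_le_sqn t : chaos s h M t <= n%:R / 20 * sqn (fun i => h i t).
Proof.
set sg := Num.sqrt (\tr M ^+ 2 + frob M M).
have sg0 : 0 < sg by rewrite sqrtr_gt0.
have QN : `|frob (outer (fun i => h i t)) M| <= sg * N t.
  rewrite -[leRHS]ger0_norm; last by rewrite mulr_ge0// ltW.
  rewrite -!sqrtr_sqr ler_sqrt ?sqr_ge0//.
  apply: (le_trans (frob_CauchySchwarz _ _)).
  rewrite frob_outer_outer exprMn mulrC sqr_sqrtr ?(ltW M_gt0)//.
  rewrite (_ : (\sum_i _) = N t); last by apply: eq_bigr => i _; rewrite expr2.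
  by rewrite ler_wpM2r ?sqr_ge0// lerDr sqr_ge0.
rewrite /chaos sn -/sg ler_pdivrMr ?mulr_gt0//.
apply: (@le_trans _ _ (n%:R * (sg * N t))); first by rewrite ler_wpM2l.
by rewrite le_eqVlt; apply/orP; left; apply/eqP; rewrite /N; field.
Qed.

Lemma chaosE t : chaos s h M t = sphere_chaos t * sqn (fun i => h i t).
Proof.
rewrite /sphere_chaos; have [N00|?] := eqVneq (sqn (fun i => h i t)) 0; last by rewrite divfK.
rewrite N00 mulr0; apply/eqP; rewrite eq_le chaos_ge0// andbT.
by apply: le_trans (chaos_le_sqn t) _; rewrite N00 mulr0.
Qed.

Lemma sphere_chaos_le t : sphere_chaos t <= n%:R / 20.
Proof.
rewrite /sphere_chaos; have [N00|Nneq0] := eqVneq (sqn (fun i => h i t)) 0.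
  by rewrite N00 invr0 mulr0 divr_ge0.
rewrite ler_pdivrMr ?chaos_le_sqn//.
by rewrite lt_def Nneq0 sqn_ge0.
Qed.

(* Either [N >= 1/2], so that the spherical chaos is at most twice the Gaussian one, or
   [N < 1/2], which has probability at most [(e^(1/4) / sqrt 2)^n]; since the spherical
   chaos never exceeds [n / 20], the second event contributes at most
   [(e^(1/20 + 1/4) / sqrt 2)^n <= 1]. *)
Lemma sphere_expR_le4 : (\int[P]_t (expR (sphere_chaos t))%:E <= 4%:E)%E.
Proof.
pose c : R := n%:R / 2.
have c0 : 0 <= c by rewrite divr_ge0.
pose K : R := expR (n%:R / 20 + n%:R / 4).
have K0 : 0 <= K by exact: expR_ge0.
have m1 : measurable_fun setT (fun t => expR (2 * V t)).
  by apply: measurableT_comp => //; apply: measurable_funM.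
have m2 : measurable_fun setT (fun t => expR (- c * N t)).
  by apply: measurableT_comp => //; apply: measurable_funM.
have p1 t : 0 <= expR (2 * V t) by exact: expR_ge0.
have p2 t : 0 <= expR (- c * N t) by exact: expR_ge0.
apply: (@le_trans _ _ (\int[P]_t (expR (2 * V t) + K * expR (- c * N t))%:E)%E).
  apply: expect_le.
  - by apply: measurableT_comp => //; exact: measurable_sphere_chaos.
  - by apply: measurable_funD => //; apply: measurable_funM.
  - move=> t; rewrite expR_ge0/=.
    have [N12|N12] := lerP (1 / 2) (N t).
      rewrite -[leLHS]addr0 lerD ?mulr_ge0// ler_expR.
      have := chaosE t; have := sphere_chaos_ge0 t; rewrite -/V -/(N t).
      by move: (sphere_chaos t) => z z0 ->; nra.
    rewrite -[leLHS]add0r lerD// -expRD ler_expR.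
    apply: (le_trans (sphere_chaos_le t)).
    have : c * N t <= c * (1 / 2) by rewrite ler_wpM2l// ltW.
    by rewrite /c mulNr; lra.
have m3 : measurable_fun setT (fun t => K * expR (- c * N t)) by apply: measurable_funM.
have p3 t : 0 <= K * expR (- c * N t) by rewrite mulr_ge0.
rewrite (expectD P m1 m3 p1 p3) (expectZ P m2 p2 K0).
have -> : 4%:E = (3%:E + 1%:E :> \bar R)%E by rewrite -EFinD; congr _%:E; ring.
apply: leeD; first exact: (chaos_expR2_le3 s0 ih sM M_gt0).
rewrite (expect_expR_neg_sqn s0 ih c0) -EFinM lee_fin.
have s2 : s ^+ 2 = n%:R^-1 by rewrite -sn invrK.
have [n0|n0] := eqVneq n 0%N; first by rewrite /K n0 !mul0r addr0 expR0 expr0 mulr1.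
have n0' : (n%:R : R) != 0 by rewrite pnatr_eq0.
have -> : 1 + 2 * c * s ^+ 2 = 2 by rewrite s2 /c; field.
have -> : K = expR (3 / 10) ^+ n by rewrite /K -expRM_natl; congr expR; field.
rewrite -exprMn exprn_ile1//.
rewrite ler_pdivrMr ?sqrtr_gt0// mul1r.
rewrite -[leLHS]ger0_norm ?expR_ge0// -sqrtr_sqr ler_sqrt//.
(* What remains is [expR (6 / 10) <= 2], which follows from [expR (1 / 10) <= 10 / 9] and
   [(10 / 9)^6 < 2]. *)
rewrite -expRM_natl (_ : 2%:R * (3 / 10) = 6%:R * 10^-1 :> R); last by field.
rewrite expRM_natl; apply: (@le_trans _ _ (((1 - 10^-1)^-1) ^+ 6)).
  by rewrite ler_pXn2r ?nnegrE ?expR_ge0 ?invr_ge0 ?expR_le_inv//; lra.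
by rewrite (_ : (1 - 10^-1)^-1 = 10 / 9 :> R); [lra|field].
Qed.

Definition sphere_const : R := @gauss_const R / (2 * (9 / @gauss_const R) ^+ 2).

Lemma sphere_const_gt0 : 0 < sphere_const.
Proof.
have g0 := @gauss_const_gt0 R.
by rewrite divr_gt0// mulr_gt0// exprn_gt0// divr_gt0.
Qed.

(* With [k = 9 / gauss_const], splitting according to [N <= k^2] yields
   [V <= k^2 Z + (V^2 + N) / (2 k)], and the last term has small mean. *)
Lemma sphere_mean_ge : (sphere_const%:E <= \int[P]_t (sphere_chaos t)%:E)%E.
Proof.
have [n0|n0] := eqVneq n 0%N.
  have : \tr M ^+ 2 + frob M M = 0.
    have n00 (i : 'I_n) : False by move: i; rewrite n0 => -[].
    rewrite /mxtrace /frob !big1 ?expr0n ?addr0//; by move=> i; case: (n00 i).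
  by move=> M0; move: M_gt0; rewrite M0 ltxx.
pose g : R := @gauss_const R; have g0 : 0 < g := @gauss_const_gt0 R.
pose k := 9 / g; have k0 : 0 < k by rewrite divr_gt0.
have n0' : (n%:R : R) != 0 by rewrite pnatr_eq0.
have mZ := measurable_sphere_chaos.
have m1 : measurable_fun setT (fun t => expR (2 * V t)).
  by apply: measurableT_comp => //; apply: measurable_funM.
have p1 t : 0 <= expR (2 * V t) by exact: expR_ge0.
have le4 := sphere_expR_le4.
have mEZ : measurable_fun setT (fun t => expR (sphere_chaos t)).
  exact: measurableT_comp.
have [z zE z0] : exists2 z, (\int[P]_t (sphere_chaos t)%:E = z%:E)%E & 0 <= z <= 4.
  apply: expect_real mZ mEZ _ le4 => t.
  by rewrite sphere_chaos_ge0 le_expR_id.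
have EN : (\int[P]_t (N t)%:E <= 6%:E)%E.
  apply: (le_trans (expect_sqn_le s0 ih)); rewrite lee_fin.
  have -> : s ^+ 2 = n%:R^-1 by rewrite -sn invrK.
  by rewrite mulrCA mulfV// mulr1.
have VE : (\int[P]_t (V t)%:E <= (k ^+ 2)%:E * z%:E + (2 * k)^-1%:E * (3%:E + 6%:E))%E.
  have k20 : 0 <= k ^+ 2 by rewrite sqr_ge0.
  have ki0 : 0 <= (2 * k)^-1 by rewrite invr_ge0 mulr_ge0// ltW.
  have m2 : measurable_fun setT (fun t => expR (2 * V t) + N t) by exact: measurable_funD.
  have p2 t : 0 <= expR (2 * V t) + N t by rewrite addr_ge0.
  apply: (@le_trans _ _ (\int[P]_t (k ^+ 2 * sphere_chaos t +
      (2 * k)^-1 * (expR (2 * V t) + N t))%:E)%E).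
    apply: expect_le => //.
      by apply: measurable_funD; apply: measurable_funM.
    move=> t; rewrite V0/=.
    have V2 : V t ^+ 2 <= expR (2 * V t).
      by rewrite expRM_natl ler_sqr ?nnegrE ?expR_ge0 ?le_expR_id.
    apply: (@le_trans _ _ (k ^+ 2 * sphere_chaos t + (2 * k)^-1 * (V t ^+ 2 + N t))); last first.
      by rewrite lerD2l ler_wpM2l// lerD2r.
    have [Nk|Nk] := lerP (N t) (k ^+ 2).
      apply: ler_wpDr; first by rewrite mulr_ge0// addr_ge0 ?sqr_ge0.
      by rewrite /V chaosE mulrC ler_wpM2r// sphere_chaos_ge0.
    (* Where [N > k^2], [2 * k * V <= V^2 + k^2 <= V^2 + N]. *)
    apply: ler_wpDl; first by rewrite mulr_ge0// sphere_chaos_ge0.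
    have kk0 : 0 < 2 * k by exact: mulr_gt0.
    rewrite ler_pdivlMl//.
    by have := sqr_ge0 (V t - k); nra.
  have m3 : measurable_fun setT (fun t => k ^+ 2 * sphere_chaos t) by exact: measurable_funM.
  have m4 : measurable_fun setT (fun t => (2 * k)^-1 * (expR (2 * V t) + N t)).
    exact: measurable_funM.
  have p3 t : 0 <= k ^+ 2 * sphere_chaos t by rewrite mulr_ge0// sphere_chaos_ge0.
  have p4 t : 0 <= (2 * k)^-1 * (expR (2 * V t) + N t) by rewrite mulr_ge0.
  rewrite (expectD P m3 m4 p3 p4).
  rewrite (expectZ P mZ sphere_chaos_ge0 k20) (expectZ P m2 p2 ki0) zE.
  rewrite leeD2lE// lee_wpmul2l ?lee_fin// (expectD P m1 mN p1 N0).
  by apply: leeD => //; exact: (chaos_expR2_le3 s0 ih sM M_gt0).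
have := le_trans (chaos_mean_ge s0 ih sM M_gt0) VE.
rewrite zE -!EFinD !lee_fin -/g => main.
(* The bounds 3 for the exponential moment and 6 for the mean of [N] dictate [k = 9 / g]: the error
   is then half of the Gaussian mean bound [g]. *)
have kE : (2 * k)^-1 * (3 + 6) = g / 2 by rewrite /k; field; rewrite gt_eqF.
have kk0 : 0 < 2 * k ^+ 2 by apply: mulr_gt0 => //; apply: exprn_gt0.
rewrite /sphere_const -/g -/k ler_pdivrMr//.
move: main; rewrite kE => main; lra.
Qed.

End spherical_chaos.

(** * Concentration *)

Section bernstein.
Context {R : realType} {dT : measure_display} {T : measurableType dT}.
Variable P : probability T R.

(** The second-order remainder is at most [(s * z)^2 * expR (s * z)]. As [s <= 1 / 2], a factor
    [expR (z / 2)] is left to absorb [z^2]. *)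
Lemma expR_upper_sqr (s z : R) : 0 <= s -> s <= 2^-1 -> 0 <= z ->
  expR (s * z) <= 1 + s * z + 16 * s ^+ 2 * expR z.
Proof.
move=> s0 s1 z0; set x := s * z.
have x0 : 0 <= x by rewrite mulr_ge0.
have e0 := expR_gt0 x.
have h1 : expR x <= 1 + x * expR x.
  have := expR_ge1Dx (- x); rewrite expRN.
  have : expR x * (expR x)^-1 = 1 by rewrite divff// gt_eqF.
  nra.
have h2 : expR x <= 1 + x + x ^+ 2 * expR x by nra.
have z2 : z ^+ 2 <= 16 * expR (z / 2).
  have := le_expR_id (z / 4); rewrite ler_pdivrMr// => z4.
  have -> : expR (z / 2) = expR (z / 4) ^+ 2 by rewrite -expRM_natl; congr expR; field.
  have -> : 16 * expR (z / 4) ^+ 2 = (expR (z / 4) * 4) ^+ 2 by ring.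
  by rewrite ler_sqr ?nnegrE ?mulr_ge0 ?expR_ge0.
have ez : expR z = expR (z / 2) * expR (z / 2) by rewrite -expRD; congr expR; field.
have main : z ^+ 2 * expR x <= 16 * expR z.
  rewrite ez mulrA; apply: ler_pM => //; first exact: sqr_ge0.
  by rewrite ler_expR /x mulrC ler_wpM2l.
apply: (le_trans h2); rewrite lerD2l.
rewrite (_ : x ^+ 2 * expR x = s ^+ 2 * (z ^+ 2 * expR x)); last by rewrite /x; ring.
by rewrite (mulrC 16) -(mulrA _ 16) ler_wpM2l ?sqr_ge0.
Qed.

(** The linear term stands on the left so that only nonnegative functions are integrated; it is
    subtracted after taking means. *)
Lemma expR_lower_sqr (s z : R) : 0 <= s -> 0 <= z ->
  expR (- (s * z)) + s * z <= 1 + 16 * s ^+ 2 * expR z.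
Proof.
move=> s0 z0; set x := s * z.
have x0 : 0 <= x by rewrite mulr_ge0.
have h : expR (- x) <= 1 - x + x ^+ 2.
  rewrite expRN; apply: (@le_trans _ _ (1 + x)^-1).
    by rewrite lef_pV2 ?posrE ?expR_gt0 ?expR_ge1Dx//; lra.
  rewrite -[leLHS]mul1r ler_pdivrMr; last by lra.
  suff : 0 <= x ^+ 3 by nra.
  exact: exprn_ge0.
have z2 : z ^+ 2 <= 16 * expR z.
  have := le_expR_id (z / 4); rewrite ler_pdivrMr// => z4.
  apply: (@le_trans _ _ (16 * expR (z / 2))); last first.
    by rewrite ler_wpM2l// ler_expR; lra.
  have -> : expR (z / 2) = expR (z / 4) ^+ 2 by rewrite -expRM_natl; congr expR; field.
  have -> : 16 * expR (z / 4) ^+ 2 = (expR (z / 4) * 4) ^+ 2 by ring.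
  by rewrite ler_sqr ?nnegrE ?mulr_ge0 ?expR_ge0.
have : x ^+ 2 <= 16 * s ^+ 2 * expR z.
  by rewrite /x exprMn (mulrC 16) -(mulrA _ 16) ler_wpM2l ?sqr_ge0.
lra.
Qed.

Lemma prob_gt0_le (W : T -> R) : measurable_fun setT W ->
  (P [set t | (0 < W t)%R] <= \int[P]_t (expR (W t))%:E)%E.
Proof.
move=> mW.
have mA : measurable [set t | 0 < W t].
  rewrite (_ : [set t | 0 < W t] = W @^-1` `]0, +oo[%classic).
    by rewrite -[X in measurable X]setTI; apply: mW.
  by apply/seteqP; split => t /=; rewrite in_itv/= andbT.
rewrite -[X in P X]setIT -(integral_indic _ measurableT mA)//.
apply: expect_le => //.
- exact: measurableT_comp.
- move=> t; rewrite indicE; case: (boolP (_ \in _)) => [|_]; last by rewrite lexx expR_ge0.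
  by rewrite inE/= => W0; rewrite ler01/= -[X in X <= _]expR0 ler_expR ltW.
Qed.

Variables (m : nat) (Z : 'I_m -> T -> R) (nu c dl : R).
Hypotheses (mZ : forall j, measurable_fun setT (Z j)) (iZ : mutually_independent P Z).
Hypotheses (Z0 : forall j t, 0 <= Z j t) (EZ : forall j, (\int[P]_t (Z j t)%:E = nu%:E)%E).
Hypothesis EeZ : forall j, (\int[P]_t (expR (Z j t))%:E <= 4%:E)%E.
Hypotheses (c0 : 0 < c) (cnu : c <= nu) (nu4 : nu <= 4) (dl0 : 0 < dl) (dl1 : dl <= 1).

(** The maximiser of [s * dl * c - 64 * s^2], with maximum [(c * dl)^2 / 256], the rate in
    [bernstein]. *)
Let s := c * dl / 128.
Let s0 : 0 <= s. Proof. by rewrite divr_ge0// mulr_ge0// ltW. Qed.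
Let s1 : s <= 2^-1. Proof.
have c4 : c <= 4 := le_trans cnu nu4.
have : c * dl <= 4 * 1 by apply: ler_pM => //; exact: ltW.
by rewrite /s; lra.
Qed.

Let meZ u j : measurable_fun setT (fun t => expR (u * Z j t)).
Proof. by apply: measurableT_comp => //; apply: measurable_funM. Qed.

Let meZ1 j : measurable_fun setT (fun t => expR (Z j t)).
Proof. exact: measurableT_comp. Qed.

Let upper_mgf j : (\int[P]_t (expR (s * Z j t))%:E <= (expR (s * nu + 64 * s ^+ 2))%:E)%E.
Proof.
have k0 : 0 <= 16 * s ^+ 2 by rewrite mulr_ge0 ?sqr_ge0.
have m1 : measurable_fun setT (fun t => s * Z j t) by exact: measurable_funM.
have m2 : measurable_fun setT (fun t => 16 * s ^+ 2 * expR (Z j t)) by exact: measurable_funM.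
have m3 : measurable_fun setT (fun t => 1 + s * Z j t) by exact: measurable_funD.
have p1 t : 0 <= s * Z j t by rewrite mulr_ge0.
have p2 t : 0 <= 16 * s ^+ 2 * expR (Z j t) by rewrite mulr_ge0 ?expR_ge0.
have p3 t : 0 <= 1 + s * Z j t by rewrite addr_ge0.
apply: (@le_trans _ _ (\int[P]_t (1 + s * Z j t + 16 * s ^+ 2 * expR (Z j t))%:E)%E).
  apply: expect_le => //; first exact: measurable_funD.
  by move=> t; rewrite expR_ge0 expR_upper_sqr.
rewrite (expectD P m3 m2 p3 p2) (@expectD _ _ _ P (fun=> 1) _ _ m1)//.
rewrite expect_cst (expectZ P (mZ j) (Z0 j) s0) EZ.
rewrite (expectZ P (meZ1 j) (fun t => expR_ge0 _) k0).
apply: (@le_trans _ _ ((1 + s * nu)%:E + (16 * s ^+ 2)%:E * 4%:E)%E).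
  by rewrite EFinD EFinM leeD2lE// lee_wpmul2l.
rewrite -EFinM -EFinD lee_fin; apply: le_trans (expR_ge1Dx _); lra.
Qed.

Let lower_mgf j : (\int[P]_t (expR (- s * Z j t))%:E <= (expR (- s * nu + 64 * s ^+ 2))%:E)%E.
Proof.
have k0 : 0 <= 16 * s ^+ 2 by rewrite mulr_ge0 ?sqr_ge0.
have m1 : measurable_fun setT (fun t => s * Z j t) by exact: measurable_funM.
have m2 : measurable_fun setT (fun t => 16 * s ^+ 2 * expR (Z j t)) by exact: measurable_funM.
have p1 t : 0 <= s * Z j t by rewrite mulr_ge0.
have p2 t : 0 <= 16 * s ^+ 2 * expR (Z j t) by rewrite mulr_ge0 ?expR_ge0.
have p3 t : 0 <= expR (- s * Z j t) by exact: expR_ge0.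
have : (\int[P]_t (expR (- s * Z j t) + s * Z j t)%:E <= (1 + 64 * s ^+ 2)%:E)%E.
  apply: (@le_trans _ _ (\int[P]_t (1 + 16 * s ^+ 2 * expR (Z j t))%:E)%E).
    apply: expect_le; [exact: measurable_funD|exact: measurable_funD|].
    by move=> t; rewrite addr_ge0//= mulNr expR_lower_sqr.
  rewrite (@expectD _ _ _ P (fun=> 1) _ _ m2)// expect_cst.
  rewrite (expectZ P (meZ1 j) (fun t => expR_ge0 _) k0).
  apply: (@le_trans _ _ (1%:E + (16 * s ^+ 2)%:E * 4%:E)%E).
    by rewrite leeD2lE// lee_wpmul2l.
  by rewrite -EFinM -EFinD lee_fin; lra.
rewrite (expectD P (meZ (- s) j) m1 p3 p1) (expectZ P (mZ j) (Z0 j) s0) EZ -EFinM.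
rewrite -leeBrDr// -EFinB => /le_trans; apply.
by rewrite lee_fin; apply: le_trans (expR_ge1Dx _); lra.
Qed.

Let chernoff_step (u a : R) :
  (forall j, (\int[P]_t (expR (u * Z j t))%:E <= (expR (u * nu + 64 * s ^+ 2))%:E)%E) ->
  (P [set t | (0 < u * (\sum_j Z j t) + m%:R * a)%R] <=
    (expR (m%:R * (u * nu + 64 * s ^+ 2 + a)))%:E)%E.
Proof.
move=> ub.
have mS : measurable_fun setT (fun t => u * \sum_j Z j t).
  by apply: measurable_funM => //; apply: measurable_sum.
apply: (le_trans (prob_gt0_le _)); first exact: measurable_funD.
have -> : (\int[P]_t (expR (u * (\sum_j Z j t) + m%:R * a))%:E =
    \int[P]_t (expR (m%:R * a) * \prod_j expR (u * Z j t))%:E)%E.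
  by apply: eq_integral => t _; rewrite expRD mulrC mulr_sumr expR_sum.
rewrite expectZ ?expR_ge0//; last 2 first.
- by apply: measurable_prod => j _; exact: meZ.
- by move=> t; apply: prodr_ge0 => j _; exact: expR_ge0.
rewrite expectation_prod; last 3 first.
- exact: meZ.
- apply: (mutually_independent_comp (f := fun x => expR (u * x)) _ iZ).
  by apply: measurableT_comp => //; apply: measurable_funM.
- by move=> j t; exact: expR_ge0.
apply: (@le_trans _ _ ((expR (m%:R * a))%:E * \prod_(j < m) (expR (u * nu + 64 * s ^+ 2))%:E)%E).
  rewrite lee_wpmul2l ?lee_fin ?expR_ge0//.
  suff /andP[] : (0 <= \prod_(j < m) \int[P]_t (expR (u * Z j t))%:E <=
      \prod_(j < m) (expR (u * nu + 64 * s ^+ 2))%:E)%E by [].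
  apply: (big_ind2 (fun x y : \bar R => 0 <= x <= y)%E) => [|x1 x2 y1 y2|j _].
  - by rewrite lexx lee_fin ler01.
  - by move=> /andP[x10 x12] /andP[y10 y12]; rewrite mule_ge0//= lee_pmul.
  - by rewrite ub andbT; apply: integral_ge0 => t _; rewrite lee_fin expR_ge0.
rewrite prodEFin prodr_const card_ord -EFinM lee_fin -expRM_natl -expRD ler_expR.
by lra.
Qed.

Lemma bernstein :
  (P [set t | (dl * (m%:R * nu) < `|\sum_j Z j t - m%:R * nu|)%R] <=
   (2 * expR (- (c * dl) ^+ 2 / 256 * m%:R))%:E)%E.
Proof.
have mS : measurable_fun setT (fun t => \sum_j Z j t) by exact: measurable_sum.
(* [A s] is the upper tail event and [A (- s)] the lower one. *)
pose A u t := 0 < u * (\sum_j Z j t) + m%:R * (- u * nu - s * dl * nu).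
have mA u : measurable [set t | A u t].
  rewrite (_ : [set t | A u t] = (fun t => u * (\sum_j Z j t) + m%:R * (- u * nu - s * dl * nu))
     @^-1` `]0, +oo[%classic).
    rewrite -[X in measurable X]setTI.
    by apply: measurable_funD => //; apply: measurable_funM.
  by apply/seteqP; split => t /=; rewrite in_itv/= andbT.
have sp : 0 < s by rewrite divr_gt0 ?mulr_gt0.
have bnd u : (forall j, (\int[P]_t (expR (u * Z j t))%:E <= (expR (u * nu + 64 * s ^+ 2))%:E)%E) ->
    (P [set t | A u t] <= (expR (- (c * dl) ^+ 2 / 256 * m%:R))%:E)%E.
  move=> /chernoff_step ub; apply: (le_trans (ub _)); rewrite lee_fin ler_expR mulrC.
  rewrite ler_wpM2r//.
  have : s * dl * c <= s * dl * nu by rewrite ler_wpM2l// mulr_ge0// ltW.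
  by rewrite /s; lra.
apply: (@le_trans _ _ (P ([set t | A s t] `|` [set t | A (- s)%R t]))).
  apply: le_measure; rewrite ?inE.
  - rewrite -[X in measurable X]setTI.
    rewrite (_ : [set t | _] =
      (fun t => `|\sum_j Z j t - m%:R * nu|) @^-1` `]dl * (m%:R * nu), +oo[%classic).
      by apply: measurableT_comp => //; apply: measurable_funB.
    by apply/seteqP; split => t /=; rewrite in_itv/= andbT.
  - exact: measurableU.
  - move=> t /=; rewrite /A ltr_normr => /orP[] h; [left|right].
      by rewrite (_ : _ + _ = s * (\sum_j Z j t - m%:R * nu - dl * (m%:R * nu)));
        [rewrite pmulr_rgt0//; lra|ring].
    by rewrite (_ : _ + _ = s * (- (\sum_j Z j t - m%:R * nu) - dl * (m%:R * nu)));
      [rewrite pmulr_rgt0//; lra|ring].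
apply: (le_trans (measureU2 _ _ _)) => //.
by rewrite mulr2n mulrDl mul1r EFinD; apply: leeD;
  [exact: (bnd _ upper_mgf)|exact: (bnd _ lower_mgf)].
Qed.

End bernstein.

(** * Both sampling laws treated together *)

Section sampling.
Context {R : realType} {dT : measure_display} {T : measurableType dT}.
Variable P : probability T R.
Implicit Types (L : Lam).

Definition absform L d (M : 'M[R]_d) (x : 'I_d -> R) : R := `|frob (outer (lam_vec L x)) M|.

Lemma absform_ge0 L d (M : 'M[R]_d) x : 0 <= absform L M x.
Proof. exact: normr_ge0. Qed.

Lemma absform_LamU d (M : 'M[R]_d) x : absform LamU M x = `|frob (outer x) M| / sqn x.
Proof.
rewrite /absform/= -[in RHS](ger0_norm (sqn_ge0 x)) -normfV -normrM; congr `|_|.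
rewrite /frob mulr_suml; apply: eq_bigr => i _; rewrite mulr_suml; apply: eq_bigr => j _.
rewrite !mxE.
have -> : (sqn x)^-1 = (Num.sqrt (sqn x))^-1 * (Num.sqrt (sqn x))^-1.
  by rewrite -invfM -expr2 sqr_sqrtr// sqn_ge0.
by rewrite /sqn; ring.
Qed.

Lemma measurable_absform L d (M : 'M[R]_d) :
  measurable_fun [set: d.-tuple R] (fun v : d.-tuple R => absform L M (tnth v)).
Proof.
have mF : measurable_fun [set: d.-tuple R] (fun v : d.-tuple R => `|frob (outer (tnth v)) M|).
  by apply: measurableT_comp => //; exact: measurable_frob_outer.
case: L => //.
rewrite (_ : (fun v : d.-tuple R => _) =
    fun v : d.-tuple R => `|frob (outer (tnth v)) M| * (sqn (tnth v)) `^ (-1)); last first.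
  by apply/funext => v; rewrite absform_LamU powR_inv1// sqn_ge0.
apply: measurable_funM => //.
have mN : measurable_fun [set: d.-tuple R] (fun v : d.-tuple R => sqn (tnth v)).
  by apply: measurable_sum => i; apply: measurable_funX; exact: measurable_tnth.
exact: (measurableT_comp (measurable_powR _) mN).
Qed.

Lemma measurable_absform_vec L d (M : 'M[R]_d) (x : 'I_d -> T -> R) :
  (forall i, measurable_fun setT (x i)) ->
  measurable_fun setT (fun t => absform L M (fun i => x i t)).
Proof.
move=> mx; rewrite [X in measurable_fun _ X](_ : _ =
    (fun v : d.-tuple R => absform L M (tnth v)) \o vec x).
  by apply: measurableT_comp; [exact: measurable_absform|exact: measurable_vec].
by apply/funext => t /=; rewrite tnth_vec.
Qed.

Definition lam_const : R := Num.min (@gauss_const R) (@sphere_const R).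

Lemma lam_const_gt0 : 0 < lam_const.
Proof. by rewrite lt_min gauss_const_gt0 sphere_const_gt0. Qed.

Lemma entry_le_frob d (M : 'M[R]_d) i j : M i j ^+ 2 <= frob M M.
Proof.
rewrite /frob (bigD1 i)//= (bigD1 j)//= -expr2 -addrA lerDl addr_ge0//.
  by apply: sumr_ge0 => k _; rewrite -expr2 sqr_ge0.
by apply: sumr_ge0 => k _; apply: sumr_ge0 => l _; rewrite -expr2 sqr_ge0.
Qed.

Lemma frob_gt0 d (M : 'M[R]_d) : M != 0 -> 0 < frob M M.
Proof.
move=> M0; rewrite lt_def frob_ge0 andbT; apply: contraNneq M0 => F0.
apply/eqP/matrixP => i j; rewrite mxE; apply/eqP; rewrite -sqrf_eq0.
by rewrite eq_le sqr_ge0 andbT -F0 entry_le_frob.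
Qed.

(** One scale [theta = 20 * sigma / d] normalises the form under both laws. It dominates the entries
    since [sigma >= |M|_F]; the polynomial lower bound on the norm comes from there. *)
Lemma absform_moments L d (h : 'I_d -> T -> R) (M : 'M[R]_d) : (0 < d)%N ->
  iid_normal P (Num.sqrt d%:R)^-1 h -> M^T = M -> M != 0 ->
  exists theta, [/\ 0 < theta, forall i j, 20 / d%:R * `|M i j| <= theta,
    (\int[P]_t (expR (absform L M (fun i => h i t) / theta))%:E <= 4%:E)%E &
    (lam_const%:E <= \int[P]_t (absform L M (fun i => h i t) / theta)%:E)%E].
Proof.
move=> d0 ih sM M0; set s := (Num.sqrt d%:R)^-1 in ih.
have d0' : 0 < d%:R :> R by rewrite ltr0n.
have s0 : 0 < s by rewrite invr_gt0 sqrtr_gt0.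
have sn : s ^- 2 = d%:R by rewrite /s exprVn invrK sqr_sqrtr// ltW.
have M_gt0 : 0 < \tr M ^+ 2 + frob M M by rewrite ltr_wpDl ?sqr_ge0// frob_gt0.
pose sg := Num.sqrt (\tr M ^+ 2 + frob M M).
have sg0 : 0 < sg by rewrite sqrtr_gt0.
have mh i : measurable_fun setT (h i) by case: ih.
exists (20 * sg / d%:R); split.
- by rewrite divr_gt0// mulr_gt0.
- move=> i j; rewrite -mulrA -[leRHS]mulrA ler_wpM2l// mulrC ler_wpM2r ?invr_ge0 ?(ltW d0')//.
  by rewrite -sqrtr_sqr ler_sqrt ?(ltW M_gt0)//; apply: le_trans (entry_le_frob M i j) _;
    rewrite lerDr sqr_ge0.
- case: L; last first.
    have -> : (\int[P]_t (expR (absform LamU M (fun i => h i t) / (20 * sg / d%:R)))%:E =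
        \int[P]_t (expR (sphere_chaos s h M t))%:E)%E.
      apply: eq_integral => t _; congr (expR _)%:E;
        rewrite absform_LamU /sphere_chaos /chaos sn -/sg.
      by rewrite invf_div; ring.
    exact: (sphere_expR_le4 s0 ih sM sn M_gt0).
  apply: le_trans (_ : (_ <= 3%:E)%E) _; last by rewrite lee_fin; lra.
  apply: le_trans (chaos_expR2_le3 s0 ih sM M_gt0); apply: expect_le.
  + apply: measurableT_comp => //; apply: measurable_funM => //.
    exact: measurable_absform_vec.
  + by apply: measurableT_comp => //; apply: measurable_funM => //;
    exact: (measurable_abs_chaos _ ih).
  + move=> t; rewrite expR_ge0 ler_expR/=.
    rewrite (_ : absform _ _ _ / _ = chaos s h M t); last
      by rewrite /chaos sn -/sg invf_div /absform/=; ring.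
    by have := chaos_ge0 h s0 M_gt0 t; lra.
- case: L.
    apply: (@le_trans _ _ (@gauss_const R)%:E); first by rewrite lee_fin ge_min lexx.
    apply: (le_trans (chaos_mean_ge s0 ih sM M_gt0)).
    rewrite le_eqVlt; apply/orP; left; apply/eqP; apply: eq_integral => t _; congr _%:E.
    by rewrite /chaos sn -/sg invf_div /absform/=; ring.
  apply: (@le_trans _ _ (@sphere_const R)%:E); first by rewrite lee_fin ge_min lexx orbT.
  apply: (le_trans (sphere_mean_ge s0 ih sM sn M_gt0)).
  rewrite le_eqVlt; apply/orP; left; apply/eqP; apply: eq_integral => t _; congr _%:E.
  rewrite absform_LamU /sphere_chaos /chaos sn -/sg.
  by rewrite invf_div; ring.
Qed.

Lemma iid_gauss_normal d (h : 'I_d -> T -> R) :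
  iid_gauss P d h -> iid_normal P (Num.sqrt d%:R)^-1 h.
Proof. by move=> [mh [ih lh]]; split. Qed.

Lemma iid_gauss_row m d (g : 'I_m -> 'I_d -> T -> R) j :
  iid_gauss P d (fun p : 'I_m * 'I_d => g p.1 p.2) -> iid_normal P (Num.sqrt d%:R)^-1 (g j).
Proof.
move=> [mg [ig lg]]; split => [i||i B mB].
- exact: (mg (j, i)).
- have je : injective (fun i : 'I_d => (j, i)) by move=> i i' [].
  exact: (mutually_independent_inj je ig).
- exact: (lg (j, i)).
Qed.

Lemma eq_law_iid_normal d s (x y : 'I_d -> T -> R) :
  iid_normal P s x -> iid_normal P s y ->
  forall f : d.-tuple R -> \bar R, measurable_fun [set: d.-tuple R] f -> (forall v, 0 <= f v)%E ->
  (\int[P]_t f (vec x t) = \int[P]_t f (vec y t))%E.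
Proof.
move=> [mx ix lx] [my iy ly]; apply: eq_law_vec => // B mB.
by rewrite ix// iy//; apply: eq_bigr => i _; rewrite lx// ly.
Qed.

Lemma expect_absform_eq L d s (x y : 'I_d -> T -> R) (M : 'M[R]_d) (f : R -> R) :
  iid_normal P s x -> iid_normal P s y -> measurable_fun setT f -> (forall r, 0 <= r -> 0 <= f r) ->
  (\int[P]_t (f (absform L M (fun i => x i t)))%:E =
   \int[P]_t (f (absform L M (fun i => y i t)))%:E)%E.
Proof.
move=> ix iy mf f0.
have := eq_law_iid_normal ix iy (f := fun v => (f (absform L M (tnth v)))%:E).
have -> : (fun t => (f (absform L M (tnth (vec x t))))%:E) =
  fun t => (f (absform L M (fun i => x i t)))%:E.
  by apply/funext => t; rewrite tnth_vec.
have -> : (fun t => (f (absform L M (tnth (vec y t))))%:E) =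
  fun t => (f (absform L M (fun i => y i t)))%:E.
  by apply/funext => t; rewrite tnth_vec.
apply.
- apply/measurable_EFinP; apply: measurableT_comp => //; exact: measurable_absform.
- by move=> v; rewrite lee_fin f0// absform_ge0.
Qed.

Lemma l1norm_rop L m d (g : 'I_m -> 'I_d -> R) (M : 'M[R]_d) :
  l1norm (rop (fun j => lam_vec L (g j)) M) = m%:R^-1 * \sum_j absform L M (g j).
Proof.
rewrite /l1norm mulr_sumr; apply: eq_bigr => j _.
by rewrite /rop normrM ger0_norm.
Qed.

(** [bernstein] is applied to the forms divided by [theta]; since the deviation event is homogeneous
    in [M], the scale cancels and the rate depends neither on [M] nor on [d]. *)
Lemma rop_concentration L m d (g : 'I_m -> 'I_d -> T -> R) (h : 'I_d -> T -> R)
    (M : 'M[R]_d) (dl : R) : (0 < d)%N -> (0 < m)%N ->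
  iid_gauss P d (fun p : 'I_m * 'I_d => g p.1 p.2) -> iid_gauss P d h ->
  M^T = M -> M != 0 -> 0 < dl -> dl <= 1 ->
  [/\ forall i j, lam_const * (20 / d%:R * `|M i j|) <= lam_norm L P h M,
    (\int[P]_t (absform L M (fun i => h i t))%:E = (lam_norm L P h M)%:E)%E &
   (P [set t | (dl * lam_norm L P h M <
     `|l1norm (rop (fun j => lam_vec L (fun i => g j i t)) M) - lam_norm L P h M|)%R] <=
   (2 * expR (- (lam_const * dl) ^+ 2 / 256 * m%:R))%:E)%E].
Proof.
move=> d0 m0 ig ih sM M0 dl0 dl1.
have nh := iid_gauss_normal ih.
have [theta [th0 thM Eexp Emean]] := absform_moments L d0 nh sM M0.
have mh i : measurable_fun setT (h i) by case: ih.
have mY : measurable_fun setT (fun t => absform L M (fun i => h i t))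
  by exact: measurable_absform_vec.
have mZ : measurable_fun setT (fun t => absform L M (fun i => h i t) / theta)
  by exact: measurable_funM.
have Z0 t : 0 <= absform L M (fun i => h i t) / theta.
  by rewrite divr_ge0 ?absform_ge0// ltW.
have meZ : measurable_fun setT (fun t => expR (absform L M (fun i => h i t) / theta)).
  exact: measurableT_comp.
have [nu nuE /andP[nu0 nu4]] : exists2 nu,
    (\int[P]_t (absform L M (fun i => h i t) / theta)%:E = nu%:E)%E & 0 <= nu <= 4.
  by apply: expect_real mZ meZ _ Eexp => t; rewrite Z0 le_expR_id.
have cnu : lam_const <= nu by rewrite -lee_fin -nuE.
have YE : (\int[P]_t (absform L M (fun i => h i t))%:E = (theta * nu)%:E)%E.
  rewrite EFinM -nuE -(expectZ P mZ Z0 (ltW th0)); apply: eq_integral => t _; congr _%:E.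
  by rewrite mulrC divfK// gt_eqF.
have normE : lam_norm L P h M = theta * nu.
  by rewrite /lam_norm unlock /= YE.
have lc0 := lam_const_gt0.
split.
- move=> i j; rewrite normE mulrC; apply: ler_pM; [|exact: ltW|exact: thM|exact: cnu].
  by rewrite mulr_ge0// divr_ge0.
- by rewrite YE normE.
pose f (v : d.-tuple R) := absform L M (tnth v) / theta.
pose Z j t := f (vec (g j) t).
have mg j i : measurable_fun setT (g j i) by have [mg _ _] := iid_gauss_row j ig.
have ZE j t : Z j t = absform L M (fun i => g j i t) / theta by rewrite /Z /f tnth_vec.
have mf : measurable_fun [set: d.-tuple R] f by apply: measurable_funM => //;
  exact: measurable_absform.
have mZj j : measurable_fun setT (Z j) by apply: measurableT_comp => //; exact: measurable_vec.
have iZ : mutually_independent P Z.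
  case: ig => mg' [ig' _].
  exact: (mutually_independent_blocks mg' ig' mf).
have Zj0 j t : 0 <= Z j t by rewrite ZE divr_ge0 ?absform_ge0// ltW.
have EZj j : (\int[P]_t (Z j t)%:E = nu%:E)%E.
  rewrite -nuE; under eq_integral do rewrite ZE.
  apply: (expect_absform_eq L M (f := fun r => r / theta) (iid_gauss_row j ig) nh).
    exact: measurable_funM.
  by move=> r r0; rewrite divr_ge0// ltW.
have EeZj j : (\int[P]_t (expR (Z j t))%:E <= 4%:E)%E.
  apply: le_trans Eexp; under eq_integral do rewrite ZE.
  rewrite (expect_absform_eq L M (f := fun r => expR (r / theta)) (iid_gauss_row j ig) nh)//.
  by apply: measurableT_comp => //; exact: measurable_funM.
have := bernstein mZj iZ Zj0 EZj EeZj lc0 cnu nu4 dl0 dl1.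
apply: le_trans; rewrite le_eqVlt; apply/orP; left; apply/eqP; congr (P _).
have mR0 : 0 < m%:R :> R by rewrite ltr0n.
have c0 : 0 < theta / m%:R by rewrite divr_gt0.
have m_neq0 : m%:R != 0 :> R by rewrite gt_eqF.
suff eqP t : (dl * lam_norm L P h M <
     `|l1norm (rop (fun j => lam_vec L (fun i => g j i t)) M) - lam_norm L P h M|) =
    (dl * (m%:R * nu) < `|\sum_j Z j t - m%:R * nu|).
  by apply/seteqP; split => t /=; rewrite eqP.
rewrite l1norm_rop normE.
have -> : m%:R^-1 * (\sum_j absform L M (fun i => g j i t)) - theta * nu =
    theta / m%:R * (\sum_j Z j t - m%:R * nu).
  under [in RHS]eq_bigr do rewrite ZE.
  rewrite -mulr_suml; field; rewrite m_neq0 gt_eqF//.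
rewrite normrM (gtr0_norm c0).
have -> : dl * (theta * nu) = theta / m%:R * (dl * (m%:R * nu)) by field.
by rewrite ltr_pM2l.
Qed.

End sampling.

(** * Secants of the model set *)

Section rayleigh.
Context {R : realType}.
Implicit Types d : nat.

Lemma frob_outer_line d (A : 'M[R]_d) (x y : 'I_d -> R) (t : R) : A^T = A ->
  frob (outer (fun i => x i + t * y i)) A =
  frob (outer x) A + t * (2 * \sum_i \sum_j x i * y j * A i j) + t ^+ 2 * frob (outer y) A.
Proof.
move=> sA; rewrite /frob.
have E1 : \sum_i \sum_j y i * x j * A i j = \sum_i \sum_j x i * y j * A i j.
  rewrite exchange_big; apply: eq_bigr => i _; apply: eq_bigr => j _.
  by rewrite -[in LHS]sA mxE (mulrC (y j)).
rewrite mulr2n mulrDl mul1r -[in X in _ + t * (X + _)]E1 mulrDr !mulr_sumr -!big_split.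
apply: eq_bigr => i _; rewrite !mulr_sumr -!big_split.
by apply: eq_bigr => j _; rewrite !mxE/=; ring.
Qed.

Lemma frob_outer_scale d (A : 'M[R]_d) (x : 'I_d -> R) (t : R) :
  frob (outer (fun i => t * x i)) A = t ^+ 2 * frob (outer x) A.
Proof.
rewrite /frob mulr_sumr; apply: eq_bigr => i _; rewrite mulr_sumr; apply: eq_bigr => j _.
by rewrite !mxE; ring.
Qed.

Lemma frob_outer_scalar d (x : 'I_d -> R) (l : R) : frob (outer x) l%:M = l * sqn x.
Proof.
rewrite /frob /sqn mulr_sumr; apply: eq_bigr => i _.
rewrite (bigD1 i)//= big1 ?addr0 => [|j ji]; rewrite !mxE ?eqxx ?mulr1n.
  by ring.
by rewrite eq_sym (negbTE ji) mulr0n mulr0.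
Qed.

Lemma linear_coef_eq0 (p q : R) : (forall t, 0 <= t * p + t ^+ 2 * q) -> p = 0.
Proof.
move=> h; apply/eqP; apply: contraT => p0.
have q1 : 0 < q ^+ 2 + 1 by rewrite ltr_pwDr// sqr_ge0.
(* A small step against the slope; [q^2 + 1 > q] makes the value negative whatever the sign of [q],
   unless [p = 0]. *)
have := h (- p / (q ^+ 2 + 1)).
have -> : - p / (q ^+ 2 + 1) * p + (- p / (q ^+ 2 + 1)) ^+ 2 * q =
  - (p ^+ 2 * (q ^+ 2 + 1 - q) / (q ^+ 2 + 1) ^+ 2) by field; rewrite gt_eqF.
rewrite oppr_ge0 leNgt divr_gt0 ?exprn_gt0// mulr_gt0//.
  by rewrite lt_def sqrf_eq0 p0 sqr_ge0.
by have := sqr_ge0 (q - 1 / 2); nra.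
Qed.

(** An isotropic vector minimises the form, so the derivative along each basis vector vanishes. *)
Lemma psd_isotropic d (A : 'M[R]_d) (x : 'I_d -> R) : A^T = A ->
  (forall y, 0 <= frob (outer y) A) -> frob (outer x) A = 0 -> (\row_i x i) *m A = 0.
Proof.
move=> sA A0 x0; apply/rowP => j; rewrite !mxE.
pose e i : R := (i == j)%:R.
have /linear_coef_eq0/eqP : forall t, 0 <= t * (2 * \sum_i \sum_k x i * e k * A i k) + t ^+ 2 * frob (outer e) A.
  by move=> t; have := A0 (fun i => x i + t * e i); rewrite frob_outer_line// x0 add0r.
rewrite mulf_eq0 pnatr_eq0/= => /eqP E; rewrite -[RHS]E; apply: eq_bigr => i _.
rewrite (bigD1 j)//= big1 ?addr0 => [|k kj]; first by rewrite mxE /e eqxx mulr1.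
by rewrite /e (negbTE kj) mulr0 mul0r.
Qed.

Lemma continuous_form d (A : 'M[R]_d) :
  continuous (fun v : 'rV[R]_d => frob (outer (fun i => v ord0 i)) A).
Proof.
apply: continuous_big; first exact: add_continuous.
move=> i _; apply: continuous_big; first exact: add_continuous.
move=> j _ v; rewrite /continuous_at; under eq_fun do rewrite mxE.
rewrite mxE; exact: (cvgM (cvgM (@coord_continuous R 1 d ord0 i v)
  (@coord_continuous R 1 d ord0 j v)) (cvg_cst _)).
Qed.

(** The form attains its minimum [l] on the compact unit sphere, at some [c]. Then [A - l%:M] is
    positive semidefinite with [c] isotropic, hence in its kernel. *)
Lemma rayleigh_min d (A : 'M[R]_d) : (0 < d)%N -> A^T = A ->
  exists2 l, eigenvalue A l & forall x, l * sqn x <= frob (outer x) A.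
Proof.
move=> d0 sA; pose N (v : 'rV[R]_d) := sqn (fun i => v ord0 i).
have NE v : N v = frob (outer (fun i => v ord0 i)) 1%:M by rewrite frob_outer_scalar mul1r.
pose S := [set v : 'rV[R]_d | N v = 1].
have cN : continuous N by rewrite (funext NE); exact: continuous_form.
have cS : compact S.
  apply: (@subclosed_compact _ _ [set v : 'rV[R]_d | forall i, `[-1 : R, 1]%classic (v ord0 i)]).
  - apply: (preimage_closed _ (@closed_eq R 1)) => y _; exact: cN.
  - by apply: (@rV_compact R d (fun=> `[-1 : R, 1]%classic)) => _; apply: segment_compact.
  - move=> v Nv i; rewrite /= in_itv/=.
    have : v ord0 i ^+ 2 <= 1.
      by rewrite -Nv /N /sqn (bigD1 i)//= lerDl sumr_ge0// => j _; rewrite sqr_ge0.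
    by move=> h; apply/andP; split; nra.
pose i0 := Ordinal d0.
have S0 : S !=set0.
  exists (delta_mx ord0 i0); rewrite /S/= /N /sqn (bigD1 i0)//= big1 ?addr0.
    by rewrite mxE !eqxx expr1n.
  by move=> j /negbTE ji; rewrite mxE eqxx ji expr0n.
pose f (v : 'rV[R]_d) := frob (outer (fun i => v ord0 i)) A.
have [c cS1 cmin] := @compact_EVT_min _ R f S S0 cS (continuous_subspaceT (@continuous_form d A)).
have Nc : N c = 1 by move: cS1; rewrite inE.
pose l := f c.
have lmin x : l * sqn x <= frob (outer x) A.
  have [x0|x0] := eqVneq (sqn x) 0.
    have x00 i : x i = 0.
      apply/eqP; rewrite -sqrf_eq0 eq_le sqr_ge0 andbT -x0 /sqn (bigD1 i)//= lerDl.
      by apply: sumr_ge0 => j _; rewrite sqr_ge0.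
    rewrite x0 mulr0 /frob big1// => i _; rewrite big1// => j _.
    by rewrite mxE x00 mul0r mul0r.
  have xp : 0 < sqn x by rewrite lt_def x0 sqn_ge0.
  pose t := (Num.sqrt (sqn x))^-1.
  have t2 : t ^+ 2 = (sqn x)^-1 by rewrite exprVn sqr_sqrtr// ltW.
  pose w : 'rV[R]_d := \row_i (t * x i).
  have wE : (fun i => w ord0 i) = (fun i => t * x i) by apply/funext => i; rewrite mxE.
  have wS : w \in S by rewrite inE /S/= NE wE frob_outer_scale frob_outer_scalar mul1r t2 mulVf.
  have := cmin _ wS; rewrite -/l /f wE frob_outer_scale t2 ler_pdivlMl//.
  by rewrite mulrC.
exists l => //; apply/eigenvalueP; exists c; last first.
  have N0 : N 0 = 0 by rewrite /N /sqn big1// => i _; rewrite mxE expr0n.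
  by apply/negP => /eqP c0; move: Nc; rewrite c0 N0 => /esym/eqP; rewrite oner_eq0.
have sB : (A - l%:M)^T = A - l%:M by rewrite linearB/= sA tr_scalar_mx.
have BE x : frob (outer x) (A - l%:M) = frob (outer x) A - l * sqn x.
  by rewrite frobDr -scaleN1r frobZr frob_outer_scalar mulN1r.
have := @psd_isotropic _ (A - l%:M) (fun i => c ord0 i) sB.
have -> : \row_i c ord0 i = c by apply/rowP => i; rewrite mxE.
move=> h; have : c *m (A - l%:M) = 0.
  apply: h => [y|]; first by rewrite BE subr_ge0.
  by rewrite BE -/(f c) -/(N c) Nc mulr1 subrr.
by rewrite mulmxBr mul_mx_scalar => /eqP; rewrite subr_eq0 => /eqP.
Qed.

Lemma spec_in_bounds d (A : 'M[R]_d) (a b : R) : (0 < d)%N -> A^T = A -> spec_in A a b ->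
  forall x, a * sqn x <= frob (outer x) A <= b * sqn x.
Proof.
move=> d0 sA spA x; apply/andP; split.
  have [l /spA/andP[al _] h] := rayleigh_min d0 sA.
  by apply: le_trans (h x); rewrite ler_wpM2r// sqn_ge0.
have sA' : (- A)^T = - A by rewrite linearN/= sA.
have [l /eigenvalueP[v vA v0] h] := rayleigh_min d0 sA'.
have /spA/andP[_ lb] : eigenvalue A (- l).
  by apply/eigenvalueP; exists v => //; rewrite -[A]opprK mulmxN vA scaleNr.
have := h x; rewrite -[- A]scaleN1r frobZr mulN1r lerNr => /le_trans; apply.
by rewrite -mulNr ler_wpM2r// sqn_ge0.
Qed.

End rayleigh.

Section secants.
Context {R : realType}.

(* The norm [`|A|] of a matrix is the maximum of the absolute values of its entries. *)

Lemma entry_le_norm m n (A : 'M[R]_(m, n)) i j : `|A i j| <= `|A|.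
Proof.
rewrite [leRHS]/Num.norm/= mx_normrE; apply/bigmax_geP; right => /=; exists (i, j) => //.
Qed.

Lemma norm_le_entries m n (A : 'M[R]_(m, n)) c : 0 <= c -> (forall i j, `|A i j| <= c) -> `|A| <= c.
Proof.
move=> c0 Ac; rewrite [leLHS]/Num.norm/= mx_normrE; by apply/bigmax_leP; split.
Qed.

Lemma norm_mulmx_le d (A B : 'M[R]_d) : `|A *m B| <= d%:R * (`|A| * `|B|).
Proof.
apply: norm_le_entries => [|i j]; first by rewrite !mulr_ge0.
rewrite mxE; apply: le_trans (ler_norm_sum _ _ _) _.
rewrite mulr_natl -[X in _ *+ X]card_ord -sumr_const; apply: ler_sum => k _.
by rewrite normrM ler_pM// entry_le_norm.
Qed.

Lemma norm_mulmx3_le d (A B C : 'M[R]_d) : `|A *m B *m C| <= d%:R ^+ 2 * (`|A| * `|B| * `|C|).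
Proof.
apply: (le_trans (norm_mulmx_le _ _)).
rewrite expr2 -mulrA ler_wpM2l// mulrA ler_wpM2r//.
exact: norm_mulmx_le.
Qed.

(** Nonnegativity at [e_i + e_j] and [e_i - e_j] gives [2 * |A i j| <= A i i + A j j]. *)
Lemma psd_entry_le d (A : 'M[R]_d) c : A^T = A -> 0 <= c ->
  (forall x, 0 <= frob (outer x) A <= c * sqn x) -> `|A| <= c.
Proof.
move=> sA c0 qA; apply: norm_le_entries => // i j.
pose e (k l : 'I_d) : R := (l == k)%:R.
have sqne k : sqn (e k) = 1.
  rewrite /sqn (bigD1 k)//= big1 ?addr0 => [|l /negbTE lk]; first by rewrite /e eqxx expr1n.
  by rewrite /e lk expr0n.
have bil : \sum_k \sum_l e i k * e j l * A k l = A i j.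
  rewrite (bigD1 i)//= (bigD1 j)//= !big1 ?addr0.
  - by rewrite /e !eqxx !mul1r.
  - by move=> k /negbTE ki; rewrite big1// => l _; rewrite /e ki !mul0r.
  - by move=> l /negbTE lj; rewrite /e lj mulr0 mul0r.
have /andP[_ qi] := qA (e i); have /andP[_ qj] := qA (e j).
rewrite !sqne mulr1 in qi qj.
have /andP[h1 _] := qA (fun k => e i k + 1 * e j k).
have /andP[h2 _] := qA (fun k => e i k + -1 * e j k).
rewrite !frob_outer_line// bil in h1 h2.
by rewrite ler_norml; apply/andP; split; lra.
Qed.

Lemma spd_unitmx d (S : 'M[R]_d) : spd S -> S \in unitmx.
Proof.
move=> [_ S0]; rewrite -row_free_unit -kermx_eq0; apply/rowV0P => v /sub_kermxP vS.
apply/eqP; apply: contraT => v0.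
have := S0 v^T; rewrite trmxK vS mul0mx mxE ltxx => /(_ _)/wrap[]//.
by apply: contra v0 => /eqP vT; rewrite -[v]trmxK vT trmx0.
Qed.

Variables (d k : nat) (a b : R).
Hypotheses (d0 : (0 < d)%N) (a0 : 0 < a) (ab : a <= b).

Lemma model_set_sym S : model_set d k a b S -> S^T = S.
Proof. by move=> [[]]. Qed.

Lemma model_set_unit S : model_set d k a b S -> S \in unitmx.
Proof. by move=> [] /spd_unitmx. Qed.

Lemma precision_sym S : model_set d k a b S -> (invmx S)^T = invmx S.
Proof. by move=> mS; rewrite trmx_inv model_set_sym. Qed.

Lemma precision_norm_le S : model_set d k a b S -> `|invmx S| <= b.
Proof.
move=> mS; have [_ [_ sp]] := mS; have b0 := lt_le_trans a0 ab.
have h := spec_in_bounds d0 (precision_sym mS) sp.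
apply: psd_entry_le (precision_sym mS) (ltW b0) _ => x.
have /andP[h1 ->] := h x; rewrite andbT; apply: le_trans h1.
by rewrite mulr_ge0 ?sqn_ge0// ltW.
Qed.

Lemma covariance_norm_le S : model_set d k a b S -> `|S| <= a^-1.
Proof.
move=> mS; have [_ [_ sp]] := mS; have b0 := lt_le_trans a0 ab.
have uS := model_set_unit mS.
have spS : spec_in S b^-1 a^-1.
  move=> l /eigenvalueP[v vS v0].
  have l0 : l != 0.
    apply: contra v0 => /eqP l0; move: vS; rewrite l0 scale0r => vS0.
    by rewrite -[v](mulmxK uS) vS0 mul0mx.
  have /sp/andP[al lb] : eigenvalue (invmx S) l^-1.
    apply/eigenvalueP; exists v => //.
    by rewrite -[v in LHS](scalerK l0) -vS scalemxAl mulmxK.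
  have li0 : 0 < l^-1 by exact: lt_le_trans al.
  by apply/andP; split; rewrite -[l]invrK lef_pV2 ?posrE.
apply: psd_entry_le (model_set_sym mS) _ _ => [|x]; first by rewrite invr_ge0 ltW.
have /andP[h1 ->] := spec_in_bounds d0 (model_set_sym mS) spS x.
by rewrite andbT; apply: le_trans h1; rewrite mulr_ge0 ?sqn_ge0// invr_ge0 ltW.
Qed.

Lemma covariance_sub (S1 S2 : 'M[R]_d) : S1 \in unitmx -> S2 \in unitmx ->
  S1 - S2 = S1 *m (invmx S2 - invmx S1) *m S2.
Proof. by move=> u1 u2; rewrite mulmxBr mulmxBl -mulmxA mulVmx// mulmx1 mulmxV// mul1mx. Qed.

Lemma covariance_sub_norm_le S S' : model_set d k a b S -> model_set d k a b S' ->
  `|S - S'| <= d%:R ^+ 2 * (a^-1 ^+ 2 * `|invmx S - invmx S'|).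
Proof.
move=> mS mS'; rewrite (covariance_sub (model_set_unit mS) (model_set_unit mS')).
apply: (le_trans (norm_mulmx3_le _ _ _)); rewrite ler_wpM2l ?exprn_ge0//.
rewrite -mulrA (mulrC `|_ - _|) mulrA distrC ler_wpM2r// expr2.
by rewrite ler_pM ?covariance_norm_le.
Qed.

Definition secant (S1 S2 : 'M[R]_d) : 'M[R]_d := `|invmx S2 - invmx S1|^-1 *: (S1 - S2).

Definition precision_dir (S1 S2 : 'M[R]_d) : 'M[R]_d :=
  `|invmx S2 - invmx S1|^-1 *: (invmx S2 - invmx S1).

Lemma precision_sub_norm_gt0 S1 S2 : model_set d k a b S1 -> model_set d k a b S2 ->
  S1 != S2 -> 0 < `|invmx S2 - invmx S1|.
Proof.
move=> m1 m2 S12; rewrite normr_gt0 subr_eq0; apply: contra S12 => /eqP h.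
by rewrite -[S1]invmxK -[S2]invmxK h.
Qed.

Lemma secantE S1 S2 : model_set d k a b S1 -> model_set d k a b S2 ->
  secant S1 S2 = S1 *m precision_dir S1 S2 *m S2.
Proof.
move=> m1 m2; rewrite /secant (covariance_sub (model_set_unit m1) (model_set_unit m2)).
by rewrite /precision_dir -scalemxAr -scalemxAl.
Qed.

Lemma precision_dir_norm S1 S2 : model_set d k a b S1 -> model_set d k a b S2 ->
  S1 != S2 -> `|precision_dir S1 S2| = 1.
Proof.
move=> m1 m2 S12; have p0 := precision_sub_norm_gt0 m1 m2 S12.
by rewrite /precision_dir normrZ normfV normr_id mulVf// gt_eqF.
Qed.

Lemma secant_sym S1 S2 : model_set d k a b S1 -> model_set d k a b S2 ->
  (secant S1 S2)^T = secant S1 S2.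
Proof. by move=> m1 m2; rewrite /secant linearZ/= linearB/= !model_set_sym. Qed.

(** Solving [secantE] for the direction, which has norm 1, costs two precision matrices of norm at
    most [b]. *)
Lemma secant_norm_ge S1 S2 : model_set d k a b S1 -> model_set d k a b S2 -> S1 != S2 ->
  1 <= d%:R ^+ 2 * b ^+ 2 * `|secant S1 S2|.
Proof.
move=> m1 m2 S12; rewrite -[leLHS](precision_dir_norm m1 m2 S12).
have -> : precision_dir S1 S2 = invmx S1 *m secant S1 S2 *m invmx S2.
  by rewrite secantE// !mulmxA mulVmx ?model_set_unit// mul1mx mulmxK ?model_set_unit.
apply: (le_trans (norm_mulmx3_le _ _ _)); rewrite -[leRHS]mulrA ler_wpM2l ?exprn_ge0//.
by rewrite mulrAC ler_wpM2r// expr2 ler_pM ?precision_norm_le.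
Qed.

(** The three factors are exchanged one at a time. Exchanging a covariance costs the factor [b / a];
    exchanging the direction costs less, as [b / a >= 1]. The hypotheses read [b * eps] because
    precision matrices are divided by [b] before rounding. *)
Lemma secant_lipschitz S1 S2 S1' S2' eps :
  model_set d k a b S1 -> model_set d k a b S2 ->
  model_set d k a b S1' -> model_set d k a b S2' -> S1 != S2 -> S1' != S2' ->
  `|invmx S1 - invmx S1'| <= b * eps -> `|invmx S2 - invmx S2'| <= b * eps ->
  `|precision_dir S1 S2 - precision_dir S1' S2'| <= eps ->
  `|secant S1 S2 - secant S1' S2'| <= 3 * (b / a) * d%:R ^+ 4 * eps * a ^- 2.
Proof.
move=> m1 m2 m1' m2' S12 S12' h1 h2 h3.
have d1 : 1 <= d%:R :> R by rewrite ler1n.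
have ai0 : 0 <= a^-1 by rewrite invr_ge0 ltW.
have eps0 : 0 <= eps by apply: le_trans h3.
have b0 : 0 <= b := ltW (lt_le_trans a0 ab).
set D := precision_dir S1 S2 in h3 *; set D' := precision_dir S1' S2' in h3 *.
have D1 : `|D| = 1 by exact: precision_dir_norm.
have D1' : `|D'| = 1 by exact: precision_dir_norm.
rewrite !secantE// -/D -/D'.
have -> : S1 *m D *m S2 - S1' *m D' *m S2' = (S1 - S1') *m D *m S2 +
   S1' *m (D - D') *m S2 + S1' *m D' *m (S2 - S2').
  by rewrite !mulmxBl !mulmxBr !mulmxBl !addrA subrK subrK.
have cb S S' : model_set d k a b S -> model_set d k a b S' ->
    `|invmx S - invmx S'| <= b * eps -> `|S - S'| <= d%:R ^+ 2 * (a^-1 ^+ 2 * (b * eps)).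
  move=> mS mS' h; apply: (le_trans (covariance_sub_norm_le mS mS')).
  by rewrite ler_wpM2l ?exprn_ge0// ler_wpM2l ?exprn_ge0.
have c1 := cb _ _ m1 m1' h1; have c2 := cb _ _ m2 m2' h2.
set X := d%:R ^+ 2 * (a^-1 ^+ 2 * (b * eps)) in c1 c2.
have X0 : 0 <= X by apply: le_trans c1.
have t1 : `|(S1 - S1') *m D *m S2| <= d%:R ^+ 2 * (X * a^-1).
  apply: (le_trans (norm_mulmx3_le _ _ _)); rewrite ler_wpM2l ?exprn_ge0//.
  by rewrite D1 mulr1 ler_pM ?covariance_norm_le.
have t3 : `|S1' *m D' *m (S2 - S2')| <= d%:R ^+ 2 * (X * a^-1).
  apply: (le_trans (norm_mulmx3_le _ _ _)); rewrite ler_wpM2l ?exprn_ge0//.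
  by rewrite D1' mulr1 mulrC ler_pM ?covariance_norm_le.
have t2 : `|S1' *m (D - D') *m S2| <= d%:R ^+ 2 * (a^-1 * eps * a^-1).
  apply: (le_trans (norm_mulmx3_le _ _ _)); rewrite ler_wpM2l ?exprn_ge0//.
  by rewrite ler_pM ?mulr_ge0 ?covariance_norm_le// ler_pM ?covariance_norm_le.
apply: (le_trans (ler_normD _ _)).
apply: (@le_trans _ _ (d%:R ^+ 2 * (X * a^-1) + d%:R ^+ 2 * (a^-1 * eps * a^-1) + d%:R ^+ 2 * (X * a^-1))).
  by apply: lerD => //; apply: le_trans (ler_normD _ _) _; exact: lerD.
have XE : d%:R ^+ 2 * (X * a^-1) = (b / a) * d%:R ^+ 4 * eps * a ^- 2.
  by rewrite /X -exprVn; ring.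
rewrite XE.
have : d%:R ^+ 2 * (a^-1 * eps * a^-1) <= (b / a) * d%:R ^+ 4 * eps * a ^- 2.
  rewrite (_ : d%:R ^+ 2 * _ = d%:R ^+ 2 * eps * a ^- 2); last by rewrite -exprVn; ring.
  rewrite ler_wpM2r ?invr_ge0 ?exprn_ge0 ?(ltW a0)//  ler_wpM2r//.
  rewrite -[leLHS]mul1r ler_pM ?exprn_ge0//; first by rewrite ler_pdivlMr ?mul1r.
  by rewrite ler_weXn2l.
by move=> ?; lra.
Qed.

End secants.

(** * Coding the secants on a grid *)

Section net.
Context {R : realType}.

(* A sparse matrix on the grid of mesh [1 / q], as a list of positions and values
   [n / q - 1].  If a position is repeated, [decode] reads an arbitrary one of its values;
   the codes built in [decode_surj] repeat a position only with the same value. *)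
Definition code (q s d : nat) := {ffun 'I_s -> ('I_d * 'I_d) * 'I_(2 * q).+1}.

Definition decode q s d (f : code q s d) : 'M[R]_d := \matrix_(i, j)
  if [pick l | (f l).1 == (i, j)] is Some l then (f l).2%:R / q%:R - 1 else 0.

Lemma card_code q s d : #|{: code q s d}| = ((d * d * (2 * q).+1) ^ s)%N.
Proof. by rewrite card_ffun card_prod card_prod !card_ord. Qed.

Lemma decode_surj q s d (A : 'M[R]_d) : (0 < q)%N -> (0 < d)%N -> `|A| <= 1 ->
  (nnz A <= s)%N -> exists f : code q s d, `|A - decode f| <= q%:R^-1.
Proof.
move=> q0 d0 A1 nA; have qp : 0 < q%:R :> R by rewrite ltr0n.
pose i0 := Ordinal d0.
pose supp := enum [set ij : 'I_d * 'I_d | A ij.1 ij.2 != 0].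
pose p (l : nat) := nth (i0, i0) supp l.
(* Shifting [[-1, 1]] to [[0, 2 * q]] before rounding down gives the [2 * q + 1] values of a
   code. *)
pose v (x : R) := Num.truncn (q%:R * (x + 1)).
have A1' i j : -1 <= A i j <= 1 by rewrite -ler_norml (le_trans (entry_le_norm _ _ _)).
have vlt i j : (v (A i j) < (2 * q).+1)%N.
  have /andP[h1 h2] := A1' i j.
  have x0 : 0 <= q%:R * (A i j + 1) by rewrite mulr_ge0//; lra.
  rewrite ltnS -(ler_nat R); have /andP[h _] := truncn_itv x0.
  by apply: (le_trans h); rewrite natrM mulrC ler_wpM2r//; lra.
(* Slots beyond the support fall on the default [(i0, i0)] and carry the rounded entry found there,
   so the padding is harmless. *)
exists [ffun l : 'I_s => (p l, inord (v (A (p l).1 (p l).2)))].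
apply: norm_le_entries => [|i j]; first by rewrite invr_ge0.
rewrite !mxE; case: pickP => [l|none].
  rewrite ffunE/= => /eqP pl; rewrite pl/= inordK//.
  have /andP[h1 h2] := A1' i j.
  have x0 : 0 <= q%:R * (A i j + 1) by rewrite mulr_ge0//; lra.
  have /andP[t1 t2] := truncn_itv x0; rewrite -/(v (A i j)) in t1 t2.
  set n : R := (v (A i j))%:R in t1 *.
  have t2' : q%:R * (A i j + 1) < n + 1 by rewrite /n -natr1 in t2 *.
  have -> : A i j - (n / q%:R - 1) = (q%:R * (A i j + 1) - n) / q%:R by field; rewrite gt_eqF.
  by rewrite ler_norml; apply/andP; split;
    rewrite ?ler_pdivlMr ?ler_pdivrMr// ?mulNr mulVf ?gt_eqF//; lra.
suff -> : A i j = 0 by rewrite subr0 normr0 invr_ge0.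
apply/eqP; apply: contraT => Aij.
have ins : (i, j) \in supp by rewrite mem_enum inE.
have ls : (index (i, j) supp < s)%N.
  by apply: leq_trans nA; rewrite /nnz cardE index_mem.
by have := none (Ordinal ls); rewrite ffunE/= /p nth_index// eqxx.
Qed.

Lemma nnzB d (A B : 'M[R]_d) : (nnz (A - B) <= nnz A + nnz B)%N.
Proof.
rewrite /nnz -cardUI; apply: leq_trans (leq_addr _ _); apply: subset_leq_card.
apply/fintype.subsetP => ij; rewrite inE/= !mxE => AB; apply/orP.
have [A0|A0] := eqVneq (A ij.1 ij.2) 0; [right|left]; rewrite inE//=.
by apply: contraNneq AB => ->; rewrite A0 subrr.
Qed.

Lemma nnzZ d c (A : 'M[R]_d) : (nnz (c *: A) <= nnz A)%N.
Proof.
apply: subset_leq_card; apply/fintype.subsetP => ij; rewrite inE/= mxE => cA.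
by rewrite inE/=; apply: contraNneq cA => ->; rewrite mulr0.
Qed.

(** The direction is supported in the union of two supports, hence [s + s] slots, and [4 * s] in
    all. *)
Definition secant_code q s d := (code q s d * code q s d * code q (s + s) d)%type.

Lemma card_secant_code q s d :
  #|{: secant_code q s d}| = ((d * d * (2 * q).+1) ^ (4 * s))%N.
Proof.
rewrite !card_prod !card_code -!expnD; congr (_ ^ _)%N.
by rewrite !mulSn mul0n addn0 -!addnA.
Qed.

Definition encodes q s d (b : R) (c : secant_code q s d) (S1 S2 : 'M[R]_d) : Prop :=
  [/\ `|b^-1 *: invmx S1 - decode c.1.1| <= q%:R^-1,
      `|b^-1 *: invmx S2 - decode c.1.2| <= q%:R^-1 &
      `|precision_dir S1 S2 - decode c.2| <= q%:R^-1].

Lemma secant_net d k q (a b : R) : (0 < d)%N -> (0 < q)%N -> 0 < a -> a <= b ->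
  exists W : secant_code q (d + 2 * k) d -> 'M[R]_d,
    (forall c, (W c)^T = W c) /\
    forall S1 S2, model_set d k a b S1 -> model_set d k a b S2 -> S1 != S2 ->
      exists2 c, W c != 0 &
        `|secant S1 S2 - W c| <= 3 * (b / a) * d%:R ^+ 4 * (2 / q%:R) * a ^- 2.
Proof.
move=> d0 q0 a0 ab; have b0 := lt_le_trans a0 ab.
pose good c (p : 'M[R]_d * 'M[R]_d) := [/\ model_set d k a b p.1, model_set d k a b p.2,
  p.1 != p.2 & @encodes q (d + 2 * k) d b c p.1 p.2].
(* An arbitrary secant of the cell, or 0 if the cell is empty. Two secants of one cell agree up to
   twice the mesh in each coded part. *)
pose W c := if pselect (exists p, good c p) is left h then
  secant (projT1 (cid h)).1 (projT1 (cid h)).2 else 0.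
have W_good c p : good c p -> exists2 p', good c p' & W c = secant p'.1 p'.2.
  move=> gp; rewrite /W; case: pselect => [h|[]]; last by exists p.
  by exists (projT1 (cid h)) => //; exact: projT2 (cid h).
exists W; split.
  move=> c; have [h|nh] := pselect (exists p, good c p).
    by case: h => p /W_good[p' [m1 m2 _ _] ->]; exact: (secant_sym m1 m2).
  by rewrite /W; case: pselect => // _; rewrite trmx0.
move=> S1 S2 m1 m2 S12.
have bn S : model_set d k a b S -> `|b^-1 *: invmx S| <= 1.
  move=> mS; rewrite normrZ normfV (gtr0_norm b0) ler_pdivrMl// mulr1.
  exact: (precision_norm_le d0 a0 ab mS).
have nz S : model_set d k a b S -> (nnz (invmx S) <= d + 2 * k)%N by case=> _ [].
have [c1 h1] := decode_surj q0 d0 (bn _ m1) (leq_trans (nnzZ _ _) (nz _ m1)).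
have [c2 h2] := decode_surj q0 d0 (bn _ m2) (leq_trans (nnzZ _ _) (nz _ m2)).
have nD : (nnz (precision_dir S1 S2) <= (d + 2 * k) + (d + 2 * k))%N.
  apply: (leq_trans (nnzZ _ _)); apply: (leq_trans (nnzB _ _)).
  by apply: leq_add; exact: nz.
have D1 : `|precision_dir S1 S2| <= 1 by rewrite (precision_dir_norm m1 m2 S12).
have [c3 h3] := decode_surj q0 d0 D1 nD.
have [[S1' S2'] [/= m1' m2' S12' [/= e1 e2 e3]] WE] := W_good (c1, c2, c3) (S1, S2) (And4 m1 m2 S12 (And3 h1 h2 h3)).
have tri (A B C : 'M[R]_d) : `|A - C| <= q%:R^-1 -> `|B - C| <= q%:R^-1 -> `|A - B| <= 2 / q%:R.
  move=> h h'; rewrite (_ : A - B = (A - C) + (C - B)); last by rewrite addrA subrK.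
  apply: (le_trans (ler_normD _ _)); rewrite [`|C - B|]distrC.
  by rewrite mulr2n mulrDl mul1r lerD.
have sc (A B : 'M[R]_d) : `|b^-1 *: A - b^-1 *: B| <= 2 / q%:R -> `|A - B| <= b * (2 / q%:R).
  by rewrite -scalerBr normrZ normfV (gtr0_norm b0) ler_pdivrMl.
exists (c1, c2, c3); rewrite WE/=.
  have := secant_norm_ge d0 a0 ab m1' m2' S12'; apply: contraTneq => ->.
  by rewrite normr0 mulr0 -ltNge ltr01.
apply: (secant_lipschitz d0 a0 ab m1 m2 m1' m2' S12 S12').
- by apply: sc; exact: tri h1 e1.
- by apply: sc; exact: tri h2 e2.
- exact: tri h3 e3.
Qed.

End net.

(** * Restricted isometry *)

Section lam_norm_theory.
Context {R : realType} {dT : measure_display} {T : measurableType dT}.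
Variable P : probability T R.
Variables (L : Lam) (d : nat).
Hypothesis d0 : (0 < d)%N.
Implicit Types M : 'M[R]_d.

Lemma absformD M1 M2 x : absform L (M1 + M2) x <= absform L M1 x + absform L M2 x.
Proof. by rewrite /absform frobDr ler_normD. Qed.

Lemma absformZ c M x : absform L (c *: M) x = `|c| * absform L M x.
Proof. by rewrite /absform frobZr normrM. Qed.

(** The summand [sqn x] serves the Gaussian law and the summand 1 the sphere. *)
Lemma absform_le M x : absform L M x <= d%:R * `|M| * (sqn x + 1).
Proof.
have QN : `|frob (outer x) M| <= d%:R * `|M| * sqn x.
  rewrite -[leRHS]ger0_norm; last by rewrite !mulr_ge0// sqn_ge0.
  rewrite -!sqrtr_sqr ler_sqrt ?sqr_ge0//.
  apply: (le_trans (frob_CauchySchwarz _ _)); rewrite frob_outer_outer.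
  rewrite (_ : \sum_i x i * x i = sqn x); last by apply: eq_bigr => i _; rewrite expr2.
  rewrite [leRHS]exprMn mulrC ler_wpM2r ?sqr_ge0//.
  apply: (@le_trans _ _ (\sum_(i < d) \sum_(j < d) `|M| ^+ 2)).
    apply: ler_sum => i _; apply: ler_sum => j _;
      rewrite -expr2 -[M i j ^+ 2]real_normK ?num_real//.
    by rewrite ler_sqr ?nnegrE ?entry_le_norm.
  by rewrite !sumr_const !card_ord -mulrnA exprMn -natrX mulr_natl mulnn.
have dM0 : 0 <= d%:R * `|M| by rewrite mulr_ge0.
case: L => //=.
  by apply: (le_trans QN); rewrite ler_wpM2l// lerDl.
rewrite absform_LamU; apply: (@le_trans _ _ (d%:R * `|M|)).
  have [x0|x0] := eqVneq (sqn x) 0; first by rewrite x0 invr0 mulr0.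
  by rewrite ler_pdivrMr// lt_def x0 sqn_ge0.
by rewrite -[leLHS]mulr1 ler_wpM2l// lerDr sqn_ge0.
Qed.

Variable h : 'I_d -> T -> R.
Hypothesis ih : iid_gauss P d h.

Let mh i : measurable_fun setT (h i). Proof. by case: ih. Qed.

Let s_gt0 : 0 < (Num.sqrt (d%:R : R))^-1.
Proof. by rewrite invr_gt0 sqrtr_gt0 ltr0n. Qed.

Lemma expect_sqn_le6 (x : 'I_d -> T -> R) : iid_normal P (Num.sqrt d%:R)^-1 x ->
  (\int[P]_t (sqn (fun i => x i t))%:E <= 6%:E)%E.
Proof.
move=> ix; apply: (le_trans (expect_sqn_le s_gt0 ix)); rewrite lee_fin.
by rewrite exprVn sqr_sqrtr// mulrCA mulfV ?mulr1// pnatr_eq0 -lt0n.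
Qed.

Lemma lam_norm_expect M :
  (\int[P]_t (absform L M (fun i => h i t))%:E = (lam_norm L P h M)%:E)%E /\
  0 <= lam_norm L P h M <= 7 * d%:R * `|M|.
Proof.
have mY : measurable_fun setT (fun t => absform L M (fun i => h i t))
  by exact: measurable_absform_vec.
have nh := iid_gauss_normal ih.
have mN := measurable_sqn nh.
have mN1 : measurable_fun setT (fun t => sqn (fun i => h i t) + 1) by exact: measurable_funD.
have mB : measurable_fun setT (fun t => d%:R * `|M| * (sqn (fun i => h i t) + 1)).
  exact: measurable_funM.
have dM0 : 0 <= d%:R * `|M| by rewrite mulr_ge0.
have [v vE v0] : exists2 v, (\int[P]_t (absform L M (fun i => h i t))%:E = v%:E)%E &
    0 <= v <= d%:R * `|M| * 7.
  apply: expect_real mY mB _ _ => [t|].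
    by rewrite absform_ge0 absform_le.
  rewrite (expectZ P mN1 _ dM0); last by move=> t; rewrite addr_ge0 ?sqn_ge0.
  rewrite [leRHS]EFinM lee_wpmul2l ?lee_fin//.
  rewrite (@expectD _ _ _ P _ (fun=> 1) mN)//; last by move=> t; exact: sqn_ge0.
  rewrite expect_cst (_ : 7%:E = 6%:E + 1%:E)%E; last by rewrite -EFinD; congr _%:E; ring.
  by apply: leeD => //; exact: expect_sqn_le6.
have nE : lam_norm L P h M = v by rewrite /lam_norm unlock /= vE.
by rewrite nE; split => //; rewrite -(mulrA 7) (mulrC 7).
Qed.

Lemma lam_normZ c M : lam_norm L P h (c *: M) = `|c| * lam_norm L P h M.
Proof.
apply: EFin_inj; rewrite -(lam_norm_expect _).1 EFinM -(lam_norm_expect M).1.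
rewrite -expectZ//.
- by apply: eq_integral => t _; rewrite absformZ.
- exact: measurable_absform_vec.
- by move=> t; exact: absform_ge0.
Qed.

Lemma lam_normD M1 M2 : lam_norm L P h (M1 + M2) <= lam_norm L P h M1 + lam_norm L P h M2.
Proof.
rewrite -lee_fin EFinD -!(lam_norm_expect _).1 -expectD//.
- apply: expect_le; first exact: measurable_absform_vec.
    by apply: measurable_funD; exact: measurable_absform_vec.
  by move=> t; rewrite absform_ge0 absformD.
- exact: measurable_absform_vec.
- exact: measurable_absform_vec.
- by move=> t; exact: absform_ge0.
- by move=> t; exact: absform_ge0.
Qed.

End lam_norm_theory.

Section empirical_norm.
Context {R : realType}.
Variables (L : Lam) (m d : nat) (g : 'I_m -> 'I_d -> R).
Implicit Types M : 'M[R]_d.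

Definition emp_norm M := l1norm (rop (fun j => lam_vec L (g j)) M).

Lemma emp_normE M : emp_norm M = m%:R^-1 * \sum_j absform L M (g j).
Proof. exact: l1norm_rop. Qed.

Lemma emp_normD M1 M2 : emp_norm (M1 + M2) <= emp_norm M1 + emp_norm M2.
Proof.
rewrite !emp_normE -mulrDr ler_wpM2l ?invr_ge0// -big_split; apply: ler_sum => j _.
exact: absformD.
Qed.

Lemma emp_normZ c M : emp_norm (c *: M) = `|c| * emp_norm M.
Proof.
rewrite !emp_normE mulrCA; congr (_ * _); rewrite mulr_sumr; apply: eq_bigr => j _.
exact: absformZ.
Qed.

Lemma emp_norm_le M : (0 < m)%N ->
  emp_norm M <= d%:R * `|M| * (m%:R^-1 * (\sum_j sqn (g j)) + 1).
Proof.
move=> m0; rewrite emp_normE.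
have -> : d%:R * `|M| * (m%:R^-1 * (\sum_j sqn (g j)) + 1) =
    m%:R^-1 * \sum_j d%:R * `|M| * (sqn (g j) + 1).
  rewrite -mulr_sumr big_split/= sumr_const card_ord; field.
  by rewrite pnatr_eq0 -lt0n.
by rewrite ler_wpM2l ?invr_ge0//; apply: ler_sum => j _; exact: absform_le.
Qed.

End empirical_norm.

Section union_bounds.
Context {R : realType} {dT : measure_display} {T : measurableType dT}.
Variable P : probability T R.

Lemma prob_bigsetU_le (I : finType) (F : I -> set T) (x : R) :
  (forall i, measurable (F i)) -> (forall i, (P (F i) <= x%:E)%E) ->
  (P (\big[setU/set0]_i F i) <= (#|I|%:R * x)%:E)%E.
Proof.
move=> mF Fx.
suff : forall r : seq I, (P (\big[setU/set0]_(i <- r) F i) <= ((size r)%:R * x)%:E)%E.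
  by move=> /(_ (index_enum I)); rewrite -sum1_size sum1_card.
elim=> [|i r IH]; first by rewrite big_nil measure0 mul0r.
rewrite big_cons; apply: (le_trans (measureU2 _ _ _)) => //.
  exact: bigsetU_measurable.
by rewrite /= -natr1 mulrDl mul1r addrC EFinD; exact: leeD.
Qed.

Lemma avg_sqn_tail (m d : nat) (g : 'I_m -> 'I_d -> T -> R) (K : R) :
  (0 < d)%N -> (0 < m)%N -> 0 < K ->
  iid_gauss P d (fun p : 'I_m * 'I_d => g p.1 p.2) ->
  measurable [set t | K < m%:R^-1 * \sum_j sqn (fun i => g j i t)] /\
  (P [set t | (K < m%:R^-1 * \sum_j sqn (fun i => g j i t))%R] <= (6 / K)%:E)%E.
Proof.
move=> d0 m0 K0 ig; set avg := fun t => m%:R^-1 * \sum_j sqn (fun i => g j i t).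
have mN j : measurable_fun setT (fun t => sqn (fun i => g j i t)).
  exact: measurable_sqn (iid_gauss_row j ig).
have mavg : measurable_fun setT avg by apply: measurable_funM => //; exact: measurable_sum.
have avg0 t : 0 <= avg t.
  by rewrite mulr_ge0 ?invr_ge0// sumr_ge0// => j _; exact: sqn_ge0.
have mA : measurable [set t | K < avg t].
  rewrite (_ : [set t | _] = avg @^-1` `]K, +oo[%classic).
    by rewrite -[X in measurable X]setTI; apply: mavg.
  by apply/seteqP; split => t /=; rewrite in_itv/= andbT.
split => //; rewrite -[X in P X]setIT -(integral_indic _ measurableT mA)//.
apply: (@le_trans _ _ (\int[P]_t (K^-1 * avg t)%:E)%E).
  apply: expect_le => //; first exact: measurable_funM.
  move=> t; rewrite indicE; case: (boolP (_ \in _)) => [|_].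
    by rewrite inE/= => Kt; rewrite ler01/= ler_pdivlMl// mulr1 ltW.
  by rewrite lexx mulr_ge0// invr_ge0 ltW.
rewrite (expectZ P mavg avg0) ?invr_ge0 ?(ltW K0)//.
rewrite expectZ ?invr_ge0//; last 2 first.
- exact: measurable_sum.
- by move=> t; rewrite sumr_ge0// => j _; exact: sqn_ge0.
rewrite mulrC EFinM lee_wpmul2l ?lee_fin ?invr_ge0 ?(ltW K0)//.
under eq_integral do rewrite -sumEFin.
rewrite ge0_integral_sum//; last 2 first.
- by move=> j; exact/measurable_EFinP.
- by move=> j t _; rewrite lee_fin sqn_ge0.
apply: (@le_trans _ _ ((m%:R^-1)%:E * \sum_(j < m) 6%:E)%E).
  rewrite lee_wpmul2l ?lee_fin ?invr_ge0//; apply: lee_sum => j _.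
  exact: (expect_sqn_le6 d0 (iid_gauss_row j ig)).
rewrite sumEFin sumr_const card_ord -EFinM lee_fin -[6 *+ m]mulr_natl mulrA mulVf ?mul1r//.
by rewrite pnatr_eq0 -lt0n.
Qed.

End union_bounds.

Section transfer.
Context {R : realType} {dT : measure_display} {T : measurableType dT}.
Variable P : probability T R.
Variables (L : Lam) (d m : nat) (h : 'I_d -> T -> R) (g : 'I_m -> 'I_d -> R).
Hypotheses (d0 : (0 < d)%N) (m0 : (0 < m)%N) (ih : iid_gauss P d h).

(** Replacing [W'] by [W] costs [(K + 1) * d * eta] in the empirical norm and [7 * d * eta] in the
    Lambda-norm, the latter counted [1 + delta / 2 <= 3 / 2] times: in total at most
    [(K + 12) * d * eta], which takes the other half of [delta]. *)
Lemma rip_transfer (W W' : 'M[R]_d) (K eta delta : R) :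
  0 <= K -> 0 <= delta <= 1 -> m%:R^-1 * (\sum_j sqn (g j)) <= K -> `|W - W'| <= eta ->
  `|emp_norm L g W' - lam_norm L P h W'| <= delta / 2 * lam_norm L P h W' ->
  (K + 12) * d%:R * eta <= delta / 2 * lam_norm L P h W ->
  `|emp_norm L g W - lam_norm L P h W| <= delta * lam_norm L P h W.
Proof.
move=> K0 /andP[dl0 dl1] avgK We H' eta_le.
have e0 : 0 <= eta by apply: le_trans We.
have de0 : 0 <= d%:R * eta by rewrite mulr_ge0.
set D := W - W'.
have eD : emp_norm L g D <= d%:R * eta * (K + 1).
  apply: (le_trans (emp_norm_le _ _ _ m0)); apply: ler_pM; rewrite ?mulr_ge0//.
  - rewrite addr_ge0// mulr_ge0 ?invr_ge0// sumr_ge0// => j _; exact: sqn_ge0.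
  - by rewrite ler_wpM2l.
  - by rewrite lerD2r.
have nD : lam_norm L P h D <= 7 * (d%:R * eta).
  have /andP[_ hD] := (lam_norm_expect L d0 ih D).2.
  by apply: (le_trans hD); rewrite -mulrA ler_wpM2l// ler_wpM2l.
have WE : W = W' + D by rewrite /D addrC subrK.
have WE' : W' = W + -1 *: D by rewrite scaleN1r /D opprB addrC subrK.
have e1 : emp_norm L g W <= emp_norm L g W' + emp_norm L g D by rewrite {1}WE; exact: emp_normD.
have e2 : emp_norm L g W' <= emp_norm L g W + emp_norm L g D.
  by have := emp_normD L g W (-1 *: D); rewrite -WE' emp_normZ normrN1 mul1r.
have n1 : lam_norm L P h W <= lam_norm L P h W' + lam_norm L P h D by rewrite {1}WE;
  exact: lam_normD.
have n2 : lam_norm L P h W' <= lam_norm L P h W + lam_norm L P h D.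
  by have := lam_normD L d0 ih W (-1 *: D); rewrite -WE' lam_normZ// normrN1 mul1r.
have n2' : delta / 2 * lam_norm L P h W' <= delta / 2 * lam_norm L P h W + 2^-1 * lam_norm L P h D.
  have /andP[D0 _] := (lam_norm_expect L d0 ih D).2.
  apply: (@le_trans _ _ (delta / 2 * (lam_norm L P h W + lam_norm L P h D))).
    by rewrite ler_wpM2l// divr_ge0.
  by rewrite mulrDr lerD2l ler_wpM2r//; lra.
move: H'; rewrite !ler_norml => /andP[h1 h2].
have := eta_le; rewrite (_ : (K + 12) * d%:R * eta = d%:R * eta * (K + 1) + 11 * (d%:R * eta));
  last by ring.
move=> h3; apply/andP; split; lra.
Qed.

End transfer.

Section counting.
Context {R : realType}.

(** The net has at most [(3 * q0 * d^10)^(4 * s)] cells. Since [ln d >= ln 2], constants such as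
    [ln (3 * q0)] and [ln (4 / rho)] are absorbed into multiples of [ln d], whence the divisions by
    [ln 2]. *)
Lemma net_size_bound (q0 d s m : nat) (kp rho : R) : (2 <= d)%N -> (1 <= q0)%N -> (1 <= s)%N ->
  0 < kp -> 0 < rho < 1 ->
  (4 * (ln (3 * q0%:R) / ln 2 + 10) + ln (4 / rho) / ln 2) / kp * (s%:R * ln d%:R) <= m%:R ->
  ((d * d * (2 * (q0 * d ^ 8)).+1) ^ (4 * s))%:R * (2 * expR (- (kp * m%:R))) <= rho / 2.
Proof.
move=> d2 q1 s1 kp0 /andP[r0 r1] hm.
have d0 : 0 < d%:R :> R by rewrite ltr0n (leq_trans _ d2).
have q0' : 0 < q0%:R :> R by rewrite ltr0n.
have s1' : 1 <= s%:R :> R by rewrite ler1n.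
have ln2 : 0 < ln 2 :> R by rewrite ln_gt0// ltr1n.
have lnd : ln 2 <= ln d%:R :> R by rewrite ler_ln ?posrE// ler_nat.
have lq0 : 0 <= ln (3 * q0%:R) :> R.
  by rewrite ln_ge0// -natrM ler1n muln_gt0.
have lr0 : 0 <= ln (4 / rho).
  by rewrite ln_ge0// ler_pdivlMr//; lra.
pose x : R := 3 * q0%:R * d%:R ^+ 10.
have x0 : 0 < x by rewrite !mulr_gt0// exprn_gt0.
have base : (d * d * (2 * (q0 * d ^ 8)).+1)%:R <= x.
  rewrite /x -natrX -!natrM ler_nat.
  have -> : (3 * q0 * d ^ 10 = d * d * (3 * (q0 * d ^ 8)))%N.
    by rewrite (expnD d 2 8) -mulnn mulnCA -(mulnA 3).
  rewrite leq_mul2l; apply/orP; right.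
  have N0 : (0 < q0 * d ^ 8)%N by rewrite muln_gt0 q1 expn_gt0 (leq_trans _ d2).
  by rewrite (mulSn 2) -add1n leq_add2r.
have lnx : ln x = ln (3 * q0%:R) + 10 * ln d%:R.
  by rewrite /x lnM ?posrE ?exprn_gt0 ?mulr_gt0// lnXn// -[_ *+ 10]mulr_natl.
have xE : x ^+ (4 * s) = expR ((4 * s)%:R * ln x) by rewrite expRM_natl lnK.
apply: (@le_trans _ _ (expR ((4 * s)%:R * ln x) * (2 * expR (- (kp * m%:R))))).
  rewrite ler_wpM2r ?mulr_ge0 ?expR_ge0// -xE natrX.
  by apply: lerXn2r; rewrite ?nnegrE ?(ltW x0).
have -> : rho / 2 = 2 * expR (- ln (4 / rho)).
  by rewrite expRN lnK ?posrE ?divr_gt0// invf_div; field.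
rewrite mulrCA ler_wpM2l// -expRD ler_expR.
suff : (4 * s)%:R * ln x + ln (4 / rho) <= kp * m%:R by lra.
move: hm; rewrite mulrAC ler_pdivrMr// mulrC => hm; rewrite [leRHS]mulrC.
apply: le_trans hm.
set u := ln (3 * q0%:R) in lq0 lnx *; set v := ln (4 / rho) in lr0 *.
have sl : ln 2 <= s%:R * ln d%:R :> R by rewrite -[leLHS]mul1r; apply: ler_pM => //; exact: ltW ln2.
have hu : s%:R * u <= s%:R * (u / ln 2 * ln d%:R).
  by rewrite ler_wpM2l// mulrAC ler_pdivlMr// ler_wpM2l.
have hv : v <= v / ln 2 * (s%:R * ln d%:R).
  by rewrite mulrAC ler_pdivlMr// ler_wpM2l.
rewrite natrM lnx; nra.
Qed.

End counting.

(** * From secants to the RIP and to recovery *)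

Section recovery.
Context {R : realType}.

Lemma rip_of_secants (L : Lam) (d m k : nat) (a b delta : R) (nrm : 'M[R]_d -> R)
    (g : 'I_m -> 'I_d -> R) :
  (0 < d)%N -> 0 < a -> a <= b ->
  (forall c M, nrm (c *: M) = `|c| * nrm M) ->
  (forall S1 S2, model_set d k a b S1 -> model_set d k a b S2 -> S1 != S2 ->
    `|emp_norm L g (secant S1 S2) - nrm (secant S1 S2)| <= delta * nrm (secant S1 S2)) ->
  RIP nrm (rop (fun j => lam_vec L (g j))) delta (model_set d k a b).
Proof.
move=> d0 a0 ab nrmZ H S1 S2 m1 m2; rewrite -/(emp_norm L g _).
have [->|S12] := eqVneq S1 S2.
  by rewrite subrr -[0](scale0r 0) nrmZ emp_normZ normr0 !mul0r !mulr0 lexx.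
have t0 := precision_sub_norm_gt0 m1 m2 S12.
set t := `|_| in t0.
have -> : S1 - S2 = t *: secant S1 S2 by rewrite /secant scalerA divff ?scale1r// gt_eqF.
rewrite nrmZ emp_normZ (gtr0_norm t0) !(mulrCA _ t) !ler_pM2l//.
have := H _ _ m1 m2 S12; rewrite ler_norml => /andP[h1 h2].
by apply/andP; split; lra.
Qed.

(** Triangle inequality through [A Sh]: optimality against the competitor [Sig] bounds one part by
    the other, hence the factor 2. The matrix [Sh] may lie outside [S]. *)
Lemma rip_recovery (m d : nat) (A : 'M[R]_d -> 'I_m -> R) (nrm : 'M[R]_d -> R)
    (delta : R) (S : set 'M[R]_d) (Sig Sh Sstar : 'M[R]_d) :
  (forall M N, A (M - N) = A M - A N) ->
  delta < 1 -> RIP nrm A delta S -> S Sig -> S Sstar ->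
  (forall S', S S' -> l1norm (A Sstar - A Sh) <= l1norm (A S' - A Sh)) ->
  nrm (Sstar - Sig) <= 2 / (1 - delta) * l1norm (A Sh - A Sig).
Proof.
move=> AB d1 rip mS mS' opt.
have l1D (x y : 'I_m -> R) : l1norm (x + y) <= l1norm x + l1norm y.
  by rewrite /l1norm -big_split; apply: ler_sum => j _; exact: ler_normD.
have l1N (x y : 'I_m -> R) : l1norm (x - y) = l1norm (y - x).
  by apply: eq_bigr => j _; rewrite -[LHS]normrN opprB.
have /andP[lo _] := rip _ _ mS' mS.
have dp : 0 < 1 - delta by lra.
rewrite mulrAC ler_pdivlMr// mulrC; apply: (le_trans lo); rewrite AB.
have -> : A Sstar - A Sig = (A Sstar - A Sh) + (A Sh - A Sig) by rewrite addrA subrK.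
apply: (le_trans (l1D _ _)); rewrite mulr2n mulrDl mul1r lerD2r.
by apply: (le_trans (opt _ mS)); rewrite l1N.
Qed.

Lemma ropB (m d : nat) (av : 'I_m -> 'I_d -> R) (M N : 'M[R]_d) :
  rop av (M - N) = rop av M - rop av N.
Proof.
apply/funext => j; rewrite /rop frobDr -scaleN1r frobZr mulN1r mulrBr.
by [].
Qed.

End recovery.

Theorem theorem3 (R : realType) (L : Lam) (delta rho : R) :
  0 < delta < 1 -> 0 < rho < 1 ->
  exists C : R -> R, (forall r : R, 0 < C r) /\
  forall (d k m : nat) (a b : R), (2 <= d)%N -> 0 < a -> a <= b ->
  forall (dT : measure_display) (T : measurableType dT) (P : probability T R)
    (g : 'I_m -> 'I_d -> T -> R) (h : 'I_d -> T -> R),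
  iid_gauss P d (fun p : 'I_m * 'I_d => g p.1 p.2) ->
  iid_gauss P d h ->
  C (b / a) * ((d + 2 * k)%N%:R * ln (d%:R : R)) <= m%:R ->
  exists E : set T, measurable E /\ ((1 - rho)%:E <= P E)%E /\
    forall t, E t ->
      let av := fun j => lam_vec L (fun i => g j i t) in
      let A := rop av in
      let nrm := lam_norm L P h in
      RIP nrm A delta (model_set d k a b) /\
      forall (Sig : 'M[R]_d), model_set d k a b Sig ->
      forall (n : nat) (x : 'I_n -> 'I_d -> R), (0 < n)%N ->
      let Sh := emp_cov x in
      forall Sstar : 'M[R]_d, model_set d k a b Sstar ->
        (forall S' : 'M[R]_d, model_set d k a b S' ->
           l1norm (A Sstar - A Sh) <= l1norm (A S' - A Sh)) ->
        nrm (Sstar - Sig) <= 2 / (1 - delta) * l1norm (A Sh - A Sig).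
Proof.
move=> /andP[dl0 dl1] /andP[r0 r1].
pose lc := @lam_const R; have lc0 : 0 < lc := @lam_const_gt0 R.
(* Markov's bound [6 / K] is then [rho / 2]; the net takes the other half. *)
pose K := 12 / rho; have K0 : 0 < K by rewrite divr_gt0.
pose G r := (K + 12) * r ^+ 3 / (delta * lc).
pose q0 r := (Num.truncn (G r)).+1.
pose kp := (lc * (delta / 2)) ^+ 2 / 256.
have kp0 : 0 < kp by rewrite divr_gt0// exprn_gt0// mulr_gt0// divr_gt0.
have ln2 : 0 < ln 2 :> R by rewrite ln_gt0// ltr1n.
exists (fun r => (4 * (ln (3 * (q0 r)%:R) / ln 2 + 10) + ln (4 / rho) / ln 2) / kp); split.
  move=> r; rewrite divr_gt0// ltr_pwDl//; last first.
    by rewrite divr_ge0 ?(ltW ln2)// ln_ge0// ler_pdivlMr//; lra.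
  rewrite mulr_gt0// ltr_wpDl// divr_ge0 ?(ltW ln2)// ln_ge0//.
  by rewrite -natrM ler1n muln_gt0.
move=> d k m a b d2 a0 ab dT T P g h ig ih mC.
have d0 : (0 < d)%N by rewrite (leq_trans _ d2).
have b0 := lt_le_trans a0 ab.
set q := q0 (b / a) in mC; set s := (d + 2 * k)%N in mC.
have s1 : (1 <= s)%N by rewrite (leq_trans d0) ?leq_addr.
have small := net_size_bound d2 (isT : (1 <= q)%N) s1 kp0 (introT andP (conj r0 r1)) mC.
(* For [m = 0] the bound [small] would put a number at least 2 below [rho / 2]. *)
have m0 : (0 < m)%N.
  rewrite lt0n; apply/negP => /eqP m00; move: small; rewrite m00 mulr0 oppr0 expR0 mulr1.
  apply/negP; rewrite -ltNge; apply: (@lt_le_trans _ _ (1 * 2)); first by lra.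
  by rewrite ler_wpM2r// ler1n expn_gt0 !muln_gt0 d0.
have qd0 : (0 < q * d ^ 8)%N by rewrite muln_gt0 expn_gt0 d0.
have [W [symW netW]] := secant_net k d0 qd0 a0 ab.
pose emp t := emp_norm L (fun j i => g j i t).
pose nrm := lam_norm L P h.
(* Concentration is available for nonzero matrices only, and the net never answers with a zero
   representative. *)
pose bad c := if W c == 0 then set0 else
  [set t | delta / 2 * nrm (W c) < `|emp t (W c) - nrm (W c)|].
pose high := [set t | K < m%:R^-1 * \sum_j sqn (fun i => g j i t)].
have [mhigh Phigh] := avg_sqn_tail d0 m0 K0 ig.
have memp M : measurable_fun setT (fun t => emp t M).
  rewrite [X in measurable_fun _ X](_ : _ =
    fun t => m%:R^-1 * \sum_j absform L M (fun i => g j i t)).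
    apply: measurable_funM => //; apply: measurable_sum => j.
    by apply: measurable_absform_vec => i; case: ig => /(_ (j, i)).
  by apply/funext => t; rewrite /emp emp_normE.
have mbad c : measurable (bad c).
  rewrite /bad; case: eqP => // _.
  rewrite (_ : [set t | _] =
    (fun t => `|emp t (W c) - nrm (W c)|) @^-1` `]delta / 2 * nrm (W c), +oo[%classic).
    rewrite -[X in measurable X]setTI; apply: measurableT_comp => //.
    exact: measurable_funB.
  by apply/seteqP; split => t /=; rewrite in_itv/= andbT.
have Pbad c : (P (bad c) <= (2 * expR (- (kp * m%:R)))%:E)%E.
  rewrite /bad; have [_|W0] := eqVneq (W c) 0.
    by rewrite measure0 lee_fin mulr_ge0// expR_ge0.
  have dl20 : 0 < delta / 2 by rewrite divr_gt0.
  have dl21 : delta / 2 <= 1 by lra.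
  have -> : - (kp * m%:R) = - (lc * (delta / 2)) ^+ 2 / 256 * m%:R by rewrite /kp; ring.
  by have [_ _] := rop_concentration L d0 m0 ig ih (symW c) W0 dl20 dl21.
pose E := ~` (high `|` \big[setU/set0]_c bad c).
have mB : measurable (high `|` \big[setU/set0]_c bad c).
  by apply: measurableU => //; exact: bigsetU_measurable.
exists E; split; first exact: measurableC.
split.
  rewrite probability_setC// EFinB leeB//.
  apply: (le_trans (measureU2 _ _ _)) => //; first exact: bigsetU_measurable.
  have -> : rho%:E = ((6 / K)%:E + (rho / 2)%:E)%E.
    by rewrite -EFinD; congr _%:E; rewrite /K; field; rewrite gt_eqF.
  apply: leeD => //; apply: (le_trans (prob_bigsetU_le mbad Pbad)).
  by rewrite card_secant_code lee_fin.
move=> t Et av A nrm'.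
have rip : RIP nrm' A delta (model_set d k a b).
  apply: (rip_of_secants d0 a0 ab) => [c M|S1 S2 m1 m2 S12]; first exact: lam_normZ.
  have [c W0 Wc] := netW _ _ m1 m2 S12.
  have avgK : m%:R^-1 * (\sum_j sqn (fun i => g j i t)) <= K.
    by rewrite leNgt; apply/negP => h1; apply: Et; left.
  have good : `|emp t (W c) - nrm (W c)| <= delta / 2 * nrm (W c).
    rewrite leNgt; apply/negP => h1; apply: Et; right.
    rewrite -bigcup_seq; exists c; first by rewrite /= mem_index_enum.
    by rewrite /bad (negbTE W0).
  apply: (rip_transfer d0 m0 ih (ltW K0) _ avgK Wc good); first by rewrite !ltW.
  have dl20 : 0 < delta / 2 by rewrite divr_gt0.
  have dl21 : delta / 2 <= 1 by lra.
  have V0 : secant S1 S2 != 0.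
    have := secant_norm_ge d0 a0 ab m1 m2 S12; apply: contraTneq => ->.
    by rewrite normr0 mulr0 -ltNge ltr01.
  have [lowV _ _] := rop_concentration L d0 m0 ig ih (secant_sym m1 m2) V0 dl20 dl21.
  have dR : 0 < d%:R :> R by rewrite ltr0n.
  have kap : 0 < b / a by rewrite divr_gt0.
  have qG : (K + 12) * (b / a) ^+ 3 <= delta * lc * q%:R.
    have dlc : 0 < delta * lc by rewrite mulr_gt0.
    rewrite -ler_pdivrMl// mulrC; apply: ltW; exact: truncnS_gt.
  (* The entrywise bound [20 * lc / d] on the norm meets the size [1 / (d^2 * b^2)] of the
     secant. *)
  have low : 20 * lc / (d%:R ^+ 3 * b ^+ 2) <= nrm (secant S1 S2).
    have V1 := secant_norm_ge d0 a0 ab m1 m2 S12.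
    have n0 : 0 <= nrm (secant S1 S2) by have [_ /andP[]] := lam_norm_expect L d0 ih (secant S1 S2).
    have V2 : `|secant S1 S2| <= nrm (secant S1 S2) * d%:R / (20 * lc).
      apply: norm_le_entries => [|i j]; first by rewrite divr_ge0 ?mulr_ge0 ?(ltW lc0).
      rewrite ler_pdivlMr ?mulr_gt0// -ler_pdivrMr//.
      by apply: le_trans (lowV i j); rewrite le_eqVlt; apply/orP; left; apply/eqP; rewrite -/lc;
        field; rewrite gt_eqF.
    rewrite ler_pdivrMr ?mulr_gt0 ?exprn_gt0//.
    have : 1 <= d%:R ^+ 2 * b ^+ 2 * (nrm (secant S1 S2) * d%:R / (20 * lc)).
      by apply: (le_trans V1); rewrite ler_wpM2l// mulr_ge0 ?exprn_ge0// ltW.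
    rewrite mulrA ler_pdivlMr ?mulr_gt0// mul1r => /le_trans; apply.
    by rewrite le_eqVlt; apply/orP; left; apply/eqP; ring.
  apply: (@le_trans _ _ (delta / 2 * (20 * lc / (d%:R ^+ 3 * b ^+ 2)))); last first.
    by rewrite ler_wpM2l// ltW.
  have qR : 0 < q%:R :> R by rewrite ltr0n.
  rewrite natrM natrX.
  (* The mesh exponent is [8 = 1 + 4 + 3]: one power of [d] from the transfer, four from the
     Lipschitz bound, three from [low]. What is left is [6 * (K + 12) * (b / a)^3 <= 10 * delta * lc
     * q], which [qG] supplies. *)
  have -> : (K + 12) * d%:R * (3 * (b / a) * d%:R ^+ 4 * (2 / (q%:R * d%:R ^+ 8)) * a ^- 2) =
      6 * ((K + 12) * (b / a) ^+ 3) / (q%:R * d%:R ^+ 3 * b ^+ 2).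
    by field; rewrite !gt_eqF.
  have -> : delta / 2 * (20 * lc / (d%:R ^+ 3 * b ^+ 2)) =
      10 * (delta * lc * q%:R) / (q%:R * d%:R ^+ 3 * b ^+ 2).
    by field; rewrite !gt_eqF.
  rewrite ler_pM2r ?invr_gt0 ?mulr_gt0 ?exprn_gt0//.
  have : 0 <= (K + 12) * (b / a) ^+ 3.
    by rewrite mulr_ge0 ?exprn_ge0 ?(ltW kap)// addr_ge0// ltW.
  lra.
split => // Sig mSig n x n0 Sh Sstar mS opt.
exact: (rip_recovery (@ropB _ _ _ av) dl1 rip mSig mS opt).
Qed.
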